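(* Let $\pi_2$ be a generator of $\mathrm{LT}[\pi^2]$. The reduction of the space $\mathbf{Y}^{\pi_2}_{3,1,e_1}$ is the affine curve defined by the equation $$-x^qy^{q^2}+xy^{q^3}=1.$$
   Context: $F$ is a non-archimedean local field of equal characteristic $p>0$ with residue field $\mathbb{F}_q$ and uniformizer $\pi$; $\mathbf{C}$ is the completion of an algebraic closure of $F$, $v$ the valuation on $\mathbf{C}$ with $v(\pi)=1$. All spaces are rigid analytic curves considered over $\mathbf{C}$. For $u\in\mathbf{C}$ with $v(u)>0$ put $[\pi]_u(X)=X^{q^2}+uX^q+\pi X$ and $[\pi^2]_u=[\pi]_u\circ[\pi]_u$. Put $[\pi]_{\mathrm{LT}}(X)=\pi X-X^q$; a generator of $\mathrm{LT}[\pi^2]$ is an element $\pi_2\in\mathbf{C}$ with $[\pi]_{\mathrm{LT}}([\pi]_{\mathrm{LT}}(\pi_2))=0$ and $[\pi]_{\mathrm{LT}}(\pi_2)\neq 0$; then $v(\pi_2)=\frac{1}{q(q-1)}$. For $X_2,Y_2$ with $[\pi^2]_u(X_2)=[\pi^2]_u(Y_2)=0$ write $X_1=[\pi]_u(X_2)$, $Y_1=[\pi]_u(Y_2)$ and $$\mu_2(X_2,Y_2)=X_1Y_2^q-X_1^qY_2-X_2^qY_1+X_2Y_1^q .$$ $\mathcal{X}^{\pi_2}(\pi^2)$ is the rigid analytic curve with $\mathbf{C}$-points $\{(u,X_2,Y_2): v(u)>0,\ [\pi^2]_u(X_2)=[\pi^2]_u(Y_2)=0,\ \mu_2(X_2,Y_2)=\pi_2\}$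 (a connected component of the Lubin-Tate space of level $\pi^2$ and height $2$). $\mathbf{Y}^{\pi_2}_{3,1,e_1}$ is the subspace of $\mathcal{X}^{\pi_2}(\pi^2)$ defined by $v(u)=\frac1{q+1}$, $v(X_1)=\frac{q}{q^2-1}$, $v(X_2)=v(Y_1)=\frac{1}{q(q^2-1)}$, $v(Y_2)=\frac{1}{q^3(q^2-1)}$. The reduction of a reduced affinoid $\mathbf{Y}$ over $\mathbf{C}$ is $\overline{\mathbf{Y}}=\mathrm{Spec}$ of the ring of power-bounded functions modulo the topologically nilpotent functions, a scheme over the residue field of $\mathbf{C}$. *)

(* Defs.v *)
From HB Require Import structures.
From mathcomp Require Import all_boot all_order all_algebra.
From mathcomp Require Import boolp classical_sets functions reals ereal.
From mathcomp Require Import ring.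

Set Implicit Arguments.
Unset Strict Implicit.
Unset Printing Implicit Defensive.

Import Order.TTheory GRing.Theory Num.Theory.
Local Open Scope ring_scope.
Local Open Scope quotient_scope.

(* MathComp's [{ideal_quot I}] requires a proof that I is proper. *)
Section RingQuot.
Variables (A : comPzRingType) (I : zmodClosed A).
Variable idealI : forall a u, u \in I -> a * u \in I.

Definition ring_quot of (forall a u, u \in I -> a * u \in I) := {ideal_quot I}.
Local Notation Q := (ring_quot idealI).

HB.instance Definition _ := GRing.Zmodule.on Q.
HB.instance Definition _ := EqQuotient.on Q.

Definition ring_quot_one : Q := \pi_{ideal_quot I} 1.
Definition ring_quot_mul (x y : Q) : Q :=
  \pi_{ideal_quot I} (repr x * repr y).

Definition ring_quot_pi (x : A) : Q := \pi_{ideal_quot I} x.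

Lemma ring_quot_piP x y : ring_quot_pi x = ring_quot_pi y <-> x - y \in I.
Proof.
by rewrite /ring_quot_pi (Quotient.idealrBE I); split=> [->//|/eqP].
Qed.

Lemma ring_quot_piK (x : Q) : ring_quot_pi (repr x) = x.
Proof. exact: reprK. Qed.

Lemma ring_quot_pi_mul x y :
  ring_quot_pi (x * y) = ring_quot_mul (ring_quot_pi x) (ring_quot_pi y).
Proof.
apply/ring_quot_piP.
set x' := repr (ring_quot_pi x); set y' := repr (ring_quot_pi y).
have hx : x - x' \in I by apply/ring_quot_piP; rewrite ring_quot_piK.
have hy : y - y' \in I by apply/ring_quot_piP; rewrite ring_quot_piK.
have -> : x * y - x' * y' = y * (x - x') + x' * (y - y').
  by rewrite !mulrBr (mulrC y x) (mulrC y x') addrA addrNK.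
by rewrite rpredD // idealI.
Qed.

Lemma ring_quot_pi_add x y :
  ring_quot_pi (x + y) = ring_quot_pi x + ring_quot_pi y.
Proof. exact: (raddfD (\pi_{ideal_quot I})). Qed.

Lemma ring_quot_mulA : associative ring_quot_mul.
Proof.
move=> x y z; rewrite -(ring_quot_piK x) -(ring_quot_piK y) -(ring_quot_piK z).
by rewrite -!ring_quot_pi_mul mulrA.
Qed.

Lemma ring_quot_mulC : commutative ring_quot_mul.
Proof.
move=> x y; rewrite -(ring_quot_piK x) -(ring_quot_piK y).
by rewrite -!ring_quot_pi_mul mulrC.
Qed.

Lemma ring_quot_mul1 : left_id ring_quot_one ring_quot_mul.
Proof.
by move=> x; rewrite -(ring_quot_piK x) -(ring_quot_pi_mul 1) mul1r.
Qed.

Lemma ring_quot_mulD : left_distributive ring_quot_mul +%R.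
Proof.
move=> x y z; rewrite -(ring_quot_piK x) -(ring_quot_piK y) -(ring_quot_piK z).
by rewrite -ring_quot_pi_add -!ring_quot_pi_mul mulrDl ring_quot_pi_add.
Qed.

Lemma ring_quot_mulDr : right_distributive ring_quot_mul +%R.
Proof.
by move=> x y z; rewrite ring_quot_mulC ring_quot_mulD !(ring_quot_mulC _ x).
Qed.

Lemma ring_quot_mul1r : right_id ring_quot_one ring_quot_mul.
Proof. by move=> x; rewrite ring_quot_mulC ring_quot_mul1. Qed.

HB.instance Definition _ := GRing.Zmodule_isPzRing.Build Q
  ring_quot_mulA ring_quot_mul1 ring_quot_mul1r ring_quot_mulD ring_quot_mulDr.
HB.instance Definition _ :=
  GRing.PzRing_hasCommutativeMul.Build Q ring_quot_mulC.

Lemma ring_quot_pi_zmod : zmod_morphism ring_quot_pi.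
Proof. exact: (raddfB (\pi_{ideal_quot I})). Qed.
HB.instance Definition _ :=
  GRing.isZmodMorphism.Build A Q ring_quot_pi ring_quot_pi_zmod.

Lemma ring_quot_pi_monoid : monoid_morphism ring_quot_pi.
Proof. by split=> // x y; exact: ring_quot_pi_mul. Qed.
HB.instance Definition _ :=
  GRing.isMonoidMorphism.Build A Q ring_quot_pi ring_quot_pi_monoid.

End RingQuot.

Section PrincipalIdeal.
Variables (A : comPzRingType) (f : A).

Definition principal_ideal : {pred A} := fun h => `[< exists g, h = g * f >].

Lemma principal_ideal_zmod : zmod_closed principal_ideal.
Proof.
split; first by apply/asboolP; exists 0; rewrite mul0r.
move=> x y /asboolP[a ->] /asboolP[b ->]; apply/asboolP.
by exists (a - b); rewrite mulrBl.
Qed.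
HB.instance Definition _ :=
  GRing.isZmodClosed.Build A principal_ideal principal_ideal_zmod.

Lemma principal_idealM a u : u \in principal_ideal -> a * u \in principal_ideal.
Proof. by move=> /asboolP[g ->]; apply/asboolP; exists (a * g); rewrite mulrA. Qed.

Definition quot_by := ring_quot principal_idealM.
HB.instance Definition _ := GRing.ComPzRing.on quot_by.
Definition quot_by_pi : {rmorphism A -> quot_by} :=
  ring_quot_pi principal_idealM.

End PrincipalIdeal.

Record valuation (R : realType) (K : fieldType) := Valuation {
  val_fun :> K -> \bar R;
  val_eqy : forall x, val_fun x = +oo%E <-> x = 0;
  val_neqNy : forall x, val_fun x <> -oo%E;
  valM : forall x y, val_fun (x * y) = (val_fun x + val_fun y)%E;
  valD : forall x y, (mine (val_fun x) (val_fun y) <= val_fun (x + y)%R)%E }.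

Section ValuationTheory.
Variables (R : realType) (K : fieldType) (v : valuation R K).

Lemma val0 : v 0 = +oo%E. Proof. exact/val_eqy. Qed.

Lemma val_fin x : x != 0 -> exists r : R, v x = r%:E.
Proof.
move=> x0; case E : (v x) => [r| |]; first by exists r.
  by move/val_eqy: E x0 => ->; rewrite eqxx.
by have := val_neqNy E.
Qed.

Lemma val1 : v 1 = 0%E.
Proof.
have [r E] := val_fin (oner_neq0 K).
have := valM v 1 1; rewrite mulr1 E -EFinD => -[] h.
by congr (_%:E); apply: (addrI r); rewrite -h addr0.
Qed.

Lemma valN1 : v (-1) = 0%E.
Proof.
have n0 : (-1 : K) != 0 by rewrite oppr_eq0 oner_neq0.
have [r E] := val_fin n0; have := valM v (-1) (-1).
rewrite mulrNN mulr1 val1 E -EFinD => -[] h.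
have : r *+ 2 == 0 by rewrite mulr2n -h.
by rewrite mulrn_eq0 => /eqP ->.
Qed.

Lemma valN x : v (- x) = v x.
Proof. by rewrite -mulN1r valM valN1 add0e. Qed.

Lemma val_leD a x y : (a <= v x -> a <= v y -> a <= v (x + y)%R)%E.
Proof. by move=> hx hy; apply: le_trans (valD v x y); rewrite le_min hx. Qed.

Lemma val_leB a x y : (a <= v x -> a <= v y -> a <= v (x - y)%R)%E.
Proof. by move=> hx hy; apply: val_leD; rewrite ?valN. Qed.

Lemma val_leM (a b : R) x y :
  (a%:E <= v x -> b%:E <= v y -> (a + b)%:E <= v (x * y)%R)%E.
Proof. by move=> hx hy; rewrite valM EFinD leeD. Qed.

Lemma val_le_sum a (I : Type) (s : seq I) (P : pred I) (F : I -> K) :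
  (forall i, P i -> a <= v (F i)%R)%E -> (a <= v (\sum_(i <- s | P i) F i)%R)%E.
Proof.
move=> h; elim/big_rec: _ => [|i x Pi hx]; first by rewrite val0 leey.
by apply: val_leD => //; exact: h.
Qed.

Lemma valV x (r : R) : v x = r%:E -> v x^-1 = (- r)%:E.
Proof.
move=> E; have x0 : x != 0.
  by apply/eqP => x0; move: E; rewrite x0 val0.
have [s Es] := val_fin (invr_neq0 x0).
have := valM v x x^-1; rewrite divff // val1 E Es -EFinD => -[] h.
by congr (_%:E); apply: (addrI r); rewrite -h subrr.
Qed.

Lemma val_real_le x : exists r : R, (r%:E <= v x)%E.
Proof.
have [->|/val_fin[r ->]] := eqVneq x 0; last by exists r.
by exists 0; rewrite val0 leey.
Qed.

Definition vcomplete : Prop := forall s : nat -> K,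
  (forall M : R, exists N, forall m n, (N <= m)%N -> (N <= n)%N ->
     (M%:E <= v (s m - s n)%R)%E) ->
  exists l, forall M : R, exists N, forall n, (N <= n)%N ->
     (M%:E <= v (s n - l)%R)%E.

Definition vint : {pred K} := fun x => (0 <= v x)%E.

Lemma vint_subring : subring_closed vint.
Proof.
split=> [|x y hx hy|x y hx hy]; rewrite unfold_in.
- by rewrite val1.
- exact: val_leB.
- by rewrite valM adde_ge0.
Qed.
HB.instance Definition _ := GRing.isSubringClosed.Build K vint vint_subring.

Record vring := VRing { vring_val :> K; vringP : vring_val \in vint }.
HB.instance Definition _ := [isSub for vring_val].
HB.instance Definition _ := [Choice of vring by <:].
HB.instance Definition _ := [SubChoice_isSubComNzRing of vring by <:].

Definition vmax : {pred vring} := fun x => (0 < v (vring_val x))%E.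

Lemma vmax_idealr : idealr_closed vmax.
Proof.
split; first by rewrite unfold_in -[vring_val]/(val) rmorph0 val0 ltry.
  by rewrite unfold_in -[vring_val]/(val) rmorph1 val1 ltxx.
move=> a x y hx hy; rewrite unfold_in -[vring_val]/(val) rmorphD rmorphM.
apply: lt_le_trans (valD v _ _); rewrite lt_min; apply/andP; split=> //.
rewrite valM; apply: lt_le_trans hx _.
by rewrite -[leLHS]add0e leeD2r //; exact: (vringP a).
Qed.
HB.instance Definition _ := isIdealr.Build vring vmax vmax_idealr.

Definition residue_field := {ideal_quot vmax}.
HB.instance Definition _ := GRing.ComNzRing.on residue_field.
Definition residue : {rmorphism vring -> residue_field} :=
  \pi_residue_field.

Lemma residueK (x : residue_field) : residue (repr x) = x.
Proof. exact: reprK. Qed.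

Lemma residue_eq0 x : (residue x == 0) = (x \in vmax).
Proof. by rewrite -(rmorph0 residue) -(Quotient.idealrBE vmax) subr0. Qed.

Definition residue_inv (x : residue_field) : residue_field :=
  if x == 0 then 0 else residue (insubd 0 (vring_val (repr x))^-1).

Lemma residue_mulV x : x != 0 -> residue_inv x * x = 1.
Proof.
move=> x0; rewrite /residue_inv (negbTE x0) -[X in _ * X]residueK -rmorphM.
have: repr x \notin vmax by rewrite -residue_eq0 residueK.
rewrite unfold_in -leNgt => hx; have := vringP (repr x); rewrite unfold_in => hx'.
have {hx hx'} vx : v (vring_val (repr x)) = 0%:E by apply/eqP; rewrite eq_le hx.
have nz : vring_val (repr x) != 0 by apply/eqP => e; move: vx; rewrite e val0.
have hV : (vring_val (repr x))^-1 \in vint.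
  by rewrite unfold_in (valV vx) oppr0.
rewrite -(rmorph1 residue); congr (residue _); apply: val_inj.
rewrite rmorphM rmorph1 /= (insubdK (0 : vring) hV).
exact: mulVf.
Qed.

Lemma residue_inv0 : residue_inv 0 = 0.
Proof. by rewrite /residue_inv eqxx. Qed.

HB.instance Definition _ :=
  GRing.ComNzRing_isField.Build residue_field residue_mulV residue_inv0.

End ValuationTheory.

(* Intended use: K is complete and algebraically closed, [pts] is the set of
   K-points of a reduced affinoid, and (gen i)_i is a closed immersion of it
   into the polydisc {v(T_i) >= rad i}.  Its affinoid algebra is then the image
   of the Tate algebra of the polydisc in the functions on [pts], because a
   function on a reduced affinoid is determined by its values at K-points. *)
Record presentation (R : realType) (K : fieldType) (v : valuation R K) :=
  Presentation {
    pts : Type;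
    idx : finType;
    gen : idx -> pts -> K;
    rad : idx -> R;
    gen_ge : forall i t, ((rad i)%:E <= v (gen i t))%E }.

Section AffinoidFunctions.
Variables (R : realType) (K : fieldType) (v : valuation R K).
Variable X : presentation v.
Local Notation multi := {ffun idx X -> nat}.
Implicit Types (n m l : multi) (c : multi -> K) (f g : pts X -> K).
Implicit Types M B : R.

Definition mdeg n : nat := (\sum_i n i)%N.
Definition weight n : R := \sum_i rad i *+ n i.
Definition monom n (t : pts X) : K := \prod_i gen i t ^+ n i.

Definition box (N : nat) : seq multi :=
  [seq [ffun i => nat_of_ord (n i)] | n : {ffun idx X -> 'I_N}].

Definition psum c N t : K := \sum_(n <- box N) c n * monom n t.

(* The series sum_n c_n T^n has Gauss valuation at least M on the polydisc. *)
Definition gauss_ge c M := forall n, (M%:E <= v (c n) + (weight n)%:E)%E.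

Definition strictly_convergent c := forall M, exists N, forall n,
  (N <= mdeg n)%N -> (M%:E <= v (c n) + (weight n)%:E)%E.

Definition has_sum c f := forall t M, exists N0, forall N, (N0 <= N)%N ->
  (M%:E <= v (f t - psum c N t)%R)%E.

Definition represents c f := strictly_convergent c /\ has_sum c f.

Definition analytic f := exists c, represents c f.

(* The balls of the residue norm, i.e. of the quotient of the Gauss norm, which
   defines the Banach topology of the affinoid algebra (up to the infimum over
   the lifts c of f being attained, which changes neither boundedness nor
   convergence to 0). *)
Definition residue_ge M f := exists c, represents c f /\ gauss_ge c M.

Definition power_bounded f :=
  analytic f /\ exists M, forall k, residue_ge M (f ^+ k).

Definition top_nilpotent f :=
  analytic f /\ forall M, exists k0, forall k, (k0 <= k)%N -> residue_ge M (f ^+ k).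

Lemma termP c n M :
  (M%:E <= v (c n) + (weight n)%:E)%E = ((M - weight n)%:E <= v (c n))%E.
Proof. by rewrite EFinB leeBlDr. Qed.

Lemma mem_box N n : (n \in box N) = [forall i, (n i < N)%N].
Proof.
apply/mapP/forallP => [[m _ ->] i|h]; first by rewrite ffunE ltn_ord.
exists [ffun i => Ordinal (h i)]; first by rewrite mem_enum.
by apply/ffunP => i; rewrite !ffunE.
Qed.

Lemma box_uniq N : uniq (box N).
Proof.
rewrite map_inj_uniq ?enum_uniq // => m l /ffunP h.
by apply/ffunP => i; have := h i; rewrite !ffunE => /val_inj.
Qed.

Lemma mdeg_out N n : n \notin box N -> (N <= mdeg n)%N.
Proof.
rewrite mem_box negb_forall => /existsP[i]; rewrite -leqNgt => h.
by apply: leq_trans h _; rewrite /mdeg (bigD1 i) //= leq_addr.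
Qed.

Definition madd n m : multi := [ffun i => (n i + m i)%N].
Definition msub n m : multi := [ffun i => (n i - m i)%N].
Definition mle m n := [forall i, (m i <= n i)%N].

Lemma maddKC m n : msub (madd m n) m = n.
Proof. by apply/ffunP => i; rewrite !ffunE addKn. Qed.
Lemma msubK m n : mle m n -> madd m (msub n m) = n.
Proof. by move/forallP=> h; apply/ffunP => i; rewrite !ffunE subnKC. Qed.
Lemma mdegD m n : mdeg (madd m n) = (mdeg m + mdeg n)%N.
Proof.
by rewrite /mdeg -big_split; apply: eq_bigr => i _; rewrite ffunE.
Qed.
Lemma weightD m n : weight (madd m n) = weight m + weight n.
Proof.
by rewrite /weight -big_split; apply: eq_bigr => i _; rewrite ffunE mulrnDr.
Qed.
Lemma monomD m n t : monom (madd m n) t = monom m t * monom n t.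
Proof.
by rewrite /monom -big_split; apply: eq_bigr => i _; rewrite ffunE exprD.
Qed.

Lemma monom_ge n t : ((weight n)%:E <= v (monom n t))%E.
Proof.
rewrite /weight /monom; elim/big_rec2: _ => [|i x y _ h].
  by rewrite val1.
rewrite addrC mulrC; apply: val_leM => //.
elim: (n i) => [|k IH]; first by rewrite expr0 val1.
by rewrite exprS mulrS; apply: val_leM => //; exact: gen_ge.
Qed.

Lemma term_ge c n t M : (M%:E <= v (c n) + (weight n)%:E)%E ->
  (M%:E <= v (c n * monom n t)%R)%E.
Proof.
rewrite termP => h; rewrite -[M](subrK (weight n)).
by apply: val_leM => //; exact: monom_ge.
Qed.

Lemma psum_ge c N t M : gauss_ge c M -> (M%:E <= v (psum c N t))%E.
Proof. by move=> h; apply: val_le_sum => n _; exact: term_ge. Qed.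

Lemma strictly_convergent_bounded c :
  strictly_convergent c -> exists M, gauss_ge c M.
Proof.
move=> /(_ 0)[N hN].
have /choice[h hh] n : exists r : R, (r%:E <= v (c n) + (weight n)%:E)%E.
  have [r hr] := val_real_le v (c n); exists (r + weight n).
  by rewrite termP addrK.
exists (- \sum_(n <- box N) `|h n|) => n.
have neg : - \sum_(n <- box N) `|h n| <= 0 by rewrite oppr_le0 sumr_ge0.
have [hn|hn] := boolP (n \in box N); last first.
  by apply: le_trans (hN n (mdeg_out hn)); rewrite lee_fin.
apply: le_trans (hh n); rewrite lee_fin (bigD1_seq n) ?box_uniq //= opprD.
apply: le_trans (_ : - `|h n| <= _); last by rewrite lerNl ler_normr lexx orbT.
by rewrite gerDl oppr_le0 sumr_ge0.
Qed.

Lemma residue_ge_analytic M f : residue_ge M f -> analytic f.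
Proof. by move=> [c [hc _]]; exists c. Qed.

Lemma analytic_residue f : analytic f -> exists M, residue_ge M f.
Proof.
move=> [c hc]; have [M hM] := strictly_convergent_bounded hc.1.
by exists M, c.
Qed.

Lemma residue_geW M B f : B <= M -> residue_ge M f -> residue_ge B f.
Proof.
move=> hB [c [hc hM]]; exists c; split=> // n.
by apply: le_trans (hM n); rewrite lee_fin.
Qed.

Lemma residue_geB M f g : residue_ge M f -> residue_ge M g ->
  residue_ge M (f - g).
Proof.
move=> [a [[sa ha] ga]] [b [[sb hb] gb]]; exists (fun n => a n - b n).
have key n B : (B%:E <= v (a n) + (weight n)%:E)%E ->
    (B%:E <= v (b n) + (weight n)%:E)%E ->
    (B%:E <= v (a n - b n)%R + (weight n)%:E)%E.
  by rewrite !(termP, termP (fun n => a n - b n)) => h1 h2; exact: val_leB.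
split; last by move=> n; exact: key.
split=> [B|t B].
  have [N1 h1] := sa B; have [N2 h2] := sb B; exists (maxn N1 N2) => n.
  by rewrite geq_max => /andP[/h1 ? /h2 ?]; exact: key.
have [N1 h1] := ha t B; have [N2 h2] := hb t B; exists (maxn N1 N2) => N.
rewrite geq_max => /andP[/h1 k1 /h2 k2].
have -> : (f - g) t - psum (fun n => a n - b n) N t =
  (f t - psum a N t) - (g t - psum b N t).
  rewrite /psum (eq_bigr _ (fun n _ => mulrBl _ _ _)) sumrB.
  have -> : (f - g) t = f t - g t by [].
  by rewrite !opprD addrACA.
exact: val_leB.
Qed.

Lemma residue_ge0 M : residue_ge M 0.
Proof.
exists (fun=> 0); split; last by move=> n; rewrite val0 addye ?leey.
split=> [B|t B]; exists 0%N => n _; first by rewrite val0 addye ?leey.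
by rewrite /psum big1 ?subrr ?val0 ?leey // => i _; rewrite mul0r.
Qed.

Lemma residue_geD M f g : residue_ge M f -> residue_ge M g ->
  residue_ge M (f + g).
Proof.
move=> hf hg; rewrite -[g]opprK; apply: residue_geB => //.
by rewrite -[- g]add0r; apply: residue_geB => //; exact: residue_ge0.
Qed.

Lemma residue_ge_sum M (I : Type) (s : seq I) (F : I -> pts X -> K) :
  (forall i, residue_ge M (F i)) -> residue_ge M (\sum_(i <- s) F i).
Proof.
move=> h; elim: s => [|i s IH]; first by rewrite big_nil; exact: residue_ge0.
by rewrite big_cons; exact: residue_geD.
Qed.

Lemma residue_geMn M f k : residue_ge M f -> residue_ge M (f *+ k).
Proof.
move=> h; elim: k => [|k IH]; first by rewrite mulr0n; exact: residue_ge0.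
by rewrite mulrS; exact: residue_geD.
Qed.

Definition mzero : multi := [ffun=> 0%N].

Lemma residue_ge_cst (a : K) M : (M%:E <= v a)%E -> residue_ge M (fun=> a).
Proof.
move=> ha; exists (fun n => if n == mzero then a else 0).
have w0 : weight mzero = 0.
  by rewrite /weight big1 // => i _; rewrite ffunE mulr0n.
split; last first.
  by move=> n; case: eqP => [->|_]; rewrite ?w0 ?adde0 // val0 addye ?leey.
split=> [B|t B]; exists 1%N => n hn.
  case: eqP => [e|_]; last by rewrite val0 addye ?leey.
  by move: hn; rewrite e /mdeg big1 // => i _; rewrite ffunE.
rewrite /psum (bigD1_seq mzero) ?box_uniq //=; last first.
  by rewrite mem_box; apply/forallP => i; rewrite ffunE.
rewrite eqxx big1 => [|i /negbTE ->]; last by rewrite mul0r.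
rewrite /monom big1 => [|i _]; last by rewrite ffunE expr0.
by rewrite mulr1 addr0 subrr val0 leey.
Qed.

Definition conv (a b : multi -> K) n : K :=
  \sum_(m <- box (mdeg n).+1 | mle m n) a m * b (msub n m).

Lemma conv_box a b n N : n \in box N ->
  conv a b n = \sum_(m <- box N | mle m n) a m * b (msub n m).
Proof.
rewrite mem_box => /forallP hn.
rewrite /conv -[LHS]big_filter -[RHS]big_filter; apply: perm_big.
apply: uniq_perm; rewrite ?filter_uniq ?box_uniq // => m.
rewrite !mem_filter; case: (boolP (mle m n)) => //= /forallP h.
rewrite !mem_box; transitivity true; last apply/esym.
  apply/forallP => i; rewrite ltnS; apply: leq_trans (h i) _.
  by rewrite /mdeg (bigD1 i) //= leq_addr.
by apply/forallP => i; exact: leq_ltn_trans (h i) (hn i).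
Qed.

Lemma psum_conv a b N t : psum (conv a b) N t =
  \sum_(m <- box N) \sum_(l <- box N | madd m l \in box N)
     (a m * monom m t) * (b l * monom l t).
Proof.
rewrite /psum big_seq.
rewrite (eq_bigr (fun n => \sum_(m <- box N | mle m n)
   a m * b (msub n m) * monom n t)); last first.
  by move=> n /(conv_box a b) ->; rewrite mulr_suml.
rewrite -big_seq (exchange_big_dep predT) //=; apply: eq_bigr => m _.
rewrite -[LHS]big_filter -[RHS]big_filter.
rewrite (perm_big
  [seq madd m l | l <- [seq l <- box N | madd m l \in box N]]); last first.
  apply: uniq_perm; rewrite ?filter_uniq ?box_uniq //.
    rewrite map_inj_uniq ?filter_uniq ?box_uniq // => l l' e.
    by rewrite -(maddKC m l) e maddKC.
  move=> n; rewrite mem_filter; apply/andP/mapP => [[h1 h2]|[l]].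
    exists (msub n m); last by rewrite msubK.
    rewrite mem_filter msubK // h2 /=.
    move: h2; rewrite !mem_box => /forallP h2; apply/forallP => i.
    by rewrite ffunE; apply: leq_ltn_trans (h2 i); exact: leq_subr.
  rewrite mem_filter => /andP[h _] ->; split=> //.
  by apply/forallP => i; rewrite ffunE leq_addr.
rewrite big_map; apply: eq_bigr => l _.
by rewrite maddKC monomD mulrACA.
Qed.

Lemma conv_term a b A B m l M N1 N2 :
  gauss_ge a A -> gauss_ge b B ->
  (forall n, (N1 <= mdeg n)%N -> ((M - B)%:E <= v (a n) + (weight n)%:E)%E) ->
  (forall n, (N2 <= mdeg n)%N -> ((M - A)%:E <= v (b n) + (weight n)%:E)%E) ->
  (N1 + N2 <= mdeg m + mdeg l)%N ->
  ((M - weight m - weight l)%:E <= v (a m * b l)%R)%E.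
Proof.
move=> gA gB hA hB hN.
have : (N1 <= mdeg m)%N \/ (N2 <= mdeg l)%N.
  have [h|h] := leqP N1 (mdeg m); first by left.
  right; rewrite -(leq_add2l N1); apply: leq_trans hN _.
  by rewrite leq_add2r ltnW.
have := gA m; have := gB l; rewrite !termP => gl gm.
case=> [/hA|/hB]; rewrite termP => h.
  have -> : M - weight m - weight l = (M - B - weight m) + (B - weight l).
    by ring.
  exact: val_leM.
have -> : M - weight m - weight l = (A - weight m) + (M - A - weight l).
  by ring.
exact: val_leM.
Qed.

Lemma conv_ge a b A B : gauss_ge a A -> gauss_ge b B ->
  gauss_ge (conv a b) (A + B).
Proof.
move=> gA gB n; rewrite termP; apply: val_le_sum => m hm.
have -> : A + B - weight n = (A - weight m) + (B - weight (msub n m)).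
  by rewrite -{1}(msubK hm) weightD opprD addrACA.
by apply: val_leM; rewrite -termP.
Qed.

Lemma residue_geM A B f g : residue_ge A f -> residue_ge B g ->
  residue_ge (A + B) (f * g).
Proof.
move=> [a [[sa ha] ga]] [b [[sb hb] gb]]; exists (conv a b).
split; last exact: conv_ge.
split=> [M|t M].
  have [N1 h1] := sa (M - B); have [N2 h2] := sb (M - A).
  exists (N1 + N2)%N => n hn; rewrite termP; apply: val_le_sum => m hm.
  have -> : M - weight n = M - weight m - weight (msub n m).
    by rewrite -{1}(msubK hm) weightD opprD addrA.
  by apply: (conv_term ga gb h1 h2); rewrite -mdegD msubK.
have [N1 h1] := sa (M - B); have [N2 h2] := sb (M - A).
have [r hr] := val_real_le v (f t).
have [N3 h3] := ha t (M - B); have [N4 h4] := hb t (M - r).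
exists (maxn (N1 + N2) (maxn N3 N4)) => N.
rewrite !geq_max => /and3P[k1 /h3 k3 /h4 k4].
have -> : (f * g) t - psum (conv a b) N t =
   (f t - psum a N t) * psum b N t + f t * (g t - psum b N t) +
   (psum a N t * psum b N t - psum (conv a b) N t).
  have -> : (f * g) t = f t * g t by [].
  by ring.
apply: val_leD; first apply: val_leD.
- by rewrite -[M](subrK B); apply: val_leM => //; exact: psum_ge.
- by rewrite -[M](subrK r) addrC; apply: val_leM.
have -> : psum a N t * psum b N t - psum (conv a b) N t =
  \sum_(m <- box N) \sum_(l <- box N | madd m l \notin box N)
     (a m * monom m t) * (b l * monom l t).
  rewrite psum_conv {1 2}/psum big_distrl -sumrB /=; apply: eq_bigr => m _.
  rewrite mulr_sumr (bigID (fun l => madd m l \in box N)) /=.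
by rewrite addrAC subrr add0r.
apply: val_le_sum => m _; apply: val_le_sum => l hl.
rewrite mulrACA -monomD -[M](subrK (weight (madd m l))).
apply: val_leM (monom_ge _ _); rewrite weightD opprD addrA.
by apply: (conv_term ga gb h1 h2); rewrite -mdegD (leq_trans k1) ?mdeg_out.
Qed.

Lemma top_nilpotent_bounded f : top_nilpotent f -> power_bounded f.
Proof.
move=> [af /(_ 0)[k0 h]]; split=> //.
have hk k : exists M, residue_ge M (f ^+ k).
  elim: k => [|k [M IH]]; first by exists 0; apply: residue_ge_cst; rewrite val1.
  have [B hB] := analytic_residue af; exists (B + M).
  by rewrite exprS; exact: residue_geM.
have /choice[M hM] := hk.
exists (- \sum_(k < k0) `|M k|) => k.
have [lt|/h] := ltnP k k0; last first.
  by apply: residue_geW; rewrite oppr_le0 sumr_ge0.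
apply: residue_geW (hM k); rewrite (bigD1 (Ordinal lt)) //= opprD.
apply: le_trans (_ : - `|M k| <= _); last by rewrite lerNl ler_normr lexx orbT.
by rewrite gerDl oppr_le0 sumr_ge0.
Qed.

Lemma analyticB f g : analytic f -> analytic g -> analytic (f - g).
Proof.
move=> /analytic_residue[A hf] /analytic_residue[B hg].
apply: (@residue_ge_analytic (Num.min A B)).
by apply: residue_geB; [apply: residue_geW hf | apply: residue_geW hg];
  rewrite ge_min lexx ?orbT.
Qed.

Lemma analyticM f g : analytic f -> analytic g -> analytic (f * g).
Proof.
move=> /analytic_residue[A hf] /analytic_residue[B hg].
exact: residue_ge_analytic (residue_geM hf hg).
Qed.

Lemma residue_ge_exprB M f g k :
  (forall i, (i <= k)%N -> residue_ge M (f ^+ (k - i) * g ^+ i)) ->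
  residue_ge M ((f - g) ^+ k).
Proof.
move=> h; rewrite exprBn; apply: residue_ge_sum => i.
apply: residue_geMn; have hi := h i (ltnSE (ltn_ord i)).
rewrite -mulrA; case: (odd i); rewrite -signr_odd; case: (odd i) => /=;
  rewrite ?expr1 ?expr0 ?mulN1r ?mul1r //.
all: by rewrite -[- _]add0r; apply: residue_geB => //; exact: residue_ge0.
Qed.

Lemma power_boundedB f g :
  power_bounded f -> power_bounded g -> power_bounded (f - g).
Proof.
move=> [af [A hA]] [ag [B hB]]; split; first exact: analyticB.
exists (A + B) => k; apply: residue_ge_exprB => i _; exact: residue_geM.
Qed.

Lemma power_boundedM f g :
  power_bounded f -> power_bounded g -> power_bounded (f * g).
Proof.
move=> [af [A hA]] [ag [B hB]]; split; first exact: analyticM.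
by exists (A + B) => k; rewrite exprMn; exact: residue_geM.
Qed.

Lemma power_bounded_cst (a : K) : (0 <= v a)%E -> power_bounded (fun=> a).
Proof.
move=> ha; split; first by apply: residue_ge_analytic (residue_ge_cst ha).
have e k : (fun=> a : K) ^+ k = (fun=> a ^+ k) :> (pts X -> K).
  elim: k => [|k IH]; first by rewrite !expr0.
  by rewrite exprS IH; apply/funext => t; rewrite exprS.
exists 0 => k; rewrite e; apply: residue_ge_cst.
elim: k => [|k IH]; first by rewrite expr0 val1.
by rewrite exprS valM adde_ge0.
Qed.

Lemma top_nilpotentB f g :
  top_nilpotent f -> top_nilpotent g -> top_nilpotent (f - g).
Proof.
move=> hf hg.
have [af [A hA]] := top_nilpotent_bounded hf.
have [ag [B hB]] := top_nilpotent_bounded hg.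
split; first exact: analyticB.
move=> M; have [k1 h1] := hf.2 (M - B); have [k2 h2] := hg.2 (M - A).
exists (k1 + k2)%N => k hk; apply: residue_ge_exprB => i hi.
have [l1|l1] := leqP k2 i.
  by rewrite -[M](subrK A) addrC; apply: residue_geM => //; exact: h2.
rewrite -[M](subrK B); apply: residue_geM => //; apply: h1.
by rewrite leq_subRL // addnC; apply: leq_trans hk; rewrite leq_add2l ltnW.
Qed.

Lemma top_nilpotentM f g :
  power_bounded f -> top_nilpotent g -> top_nilpotent (f * g).
Proof.
move=> [af [A hA]] [ag h]; split; first exact: analyticM.
move=> M; have [k0 hk] := h (M - A); exists k0 => k /hk {}hk.
by rewrite exprMn -[M](subrK A) addrC; exact: residue_geM.
Qed.

Definition pbounded : {pred pts X -> K} :=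
  fun f => `[< power_bounded f >].

Lemma pbounded_subring : subring_closed pbounded.
Proof.
split=> [|f g /asboolP hf /asboolP hg|f g /asboolP hf /asboolP hg]; apply/asboolP.
- by apply: power_bounded_cst; rewrite val1.
- exact: power_boundedB.
- exact: power_boundedM.
Qed.
HB.instance Definition _ :=
  GRing.isSubringClosed.Build (pts X -> K) pbounded pbounded_subring.

Record pb_ring := PbRing { pb_fun :> pts X -> K; pb_funP : pb_fun \in pbounded }.
HB.instance Definition _ := [isSub for pb_fun].
HB.instance Definition _ := [Choice of pb_ring by <:].
HB.instance Definition _ :=
  GRing.SubChoice_isSubComPzRing.Build (pts X -> K) pbounded pb_ring
    pbounded_subring.

Definition tnilp : {pred pb_ring} :=
  fun a => `[< top_nilpotent (pb_fun a) >].

Lemma tnilp_zmod : zmod_closed tnilp.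
Proof.
split=> [|f g /asboolP hf /asboolP hg]; apply/asboolP.
  rewrite -[pb_fun]/(val) rmorph0; split.
    exact: residue_ge_analytic (residue_ge0 0).
  move=> M; exists 1%N => -[|k] // _.
  by rewrite expr0n; exact: residue_ge0.
rewrite -[pb_fun]/(val) rmorphB; exact: top_nilpotentB.
Qed.
HB.instance Definition _ := GRing.isZmodClosed.Build pb_ring tnilp tnilp_zmod.

Lemma tnilpM (a u : pb_ring) : u \in tnilp -> a * u \in tnilp.
Proof.
move=> /asboolP hu; apply/asboolP; rewrite -[pb_fun]/(val) rmorphM.
by apply: top_nilpotentM => //; apply/asboolP; exact: (pb_funP a).
Qed.

Definition reduction := ring_quot tnilpM.
HB.instance Definition _ := GRing.ComPzRing.on reduction.

Definition reduce : {rmorphism pb_ring -> reduction} := ring_quot_pi tnilpM.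

(* Constant functions; they induce on [reduction] its structure of algebra over
   the residue field of K. *)
Lemma pb_cst_subproof (a : vring v) : (fun=> vring_val a) \in pbounded.
Proof. by apply/asboolP; apply: power_bounded_cst; exact: (vringP a). Qed.
Definition pb_cst (a : vring v) : pb_ring := PbRing (pb_cst_subproof a).

End AffinoidFunctions.

Record local_field (R : realType) (p q : nat) (F : fieldType)
    (vF : valuation R F) (pi : F) : Prop := {
  local_char : p \in [pchar F];
  local_complete : vcomplete vF;
  local_uniformizer : vF pi = 1%:E;
  local_discrete : forall x, x != 0 -> exists n : int, vF x = (n%:~R)%:E;
  local_residue : exists e : 'I_q -> residue_field vF, bijective e }.

(* C is a completion of the algebraic closure Fbar of F, with F -> Fbar -> C
   given by i and j, and v extends vF. *)
Record completed_closure (R : realType) (F : fieldType) (vF : valuation R F)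
    (Fbar : closedFieldType) (C : fieldType) (v : valuation R C)
    (i : {rmorphism F -> Fbar}) (j : {rmorphism Fbar -> C}) : Prop := {
  closure_algebraic : forall a, algebraicOver i a;
  closure_val : forall x, v (j (i x)) = vF x;
  closure_dense : forall (x : C) (M : R), exists a, (M%:E <= v (x - j a)%R)%E;
  closure_complete : vcomplete v }.

Section LubinTate.
Variables (R : realType) (C : fieldType) (v : valuation R C).
Variables (q : nat) (pi : C).

Definition pi_u (u X : C) : C := X ^+ (q ^ 2) + u * X ^+ q + pi * X.
Definition pi2_u (u X : C) : C := pi_u u (pi_u u X).
Definition pi_LT (X : C) : C := pi * X - X ^+ q.

Definition LT_generator (pi2 : C) : Prop :=
  pi_LT (pi_LT pi2) = 0 /\ pi_LT pi2 <> 0.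

Definition mu2 (u X2 Y2 : C) : C :=
  let X1 := pi_u u X2 in let Y1 := pi_u u Y2 in
  X1 * Y2 ^+ q - X1 ^+ q * Y2 - X2 ^+ q * Y1 + X2 * Y1 ^+ q.

Record lubin_tate_point (pi2 : C) := LubinTatePoint {
  pt_u : C;
  pt_X2 : C;
  pt_Y2 : C;
  pt_u_gt0 : (0 < v pt_u)%E;
  pt_X2_torsion : pi2_u pt_u pt_X2 = 0;
  pt_Y2_torsion : pi2_u pt_u pt_Y2 = 0;
  pt_mu2 : mu2 pt_u pt_X2 pt_Y2 = pi2 }.

Definition pt_X1 pi2 (P : lubin_tate_point pi2) : C := pi_u (pt_u P) (pt_X2 P).
Definition pt_Y1 pi2 (P : lubin_tate_point pi2) : C := pi_u (pt_u P) (pt_Y2 P).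

Local Notation Q := (q%:R : R).
Definition rad_u  : R := (Q + 1)^-1.
Definition rad_X1 : R := Q / (Q ^+ 2 - 1).
Definition rad_X2 : R := (Q * (Q ^+ 2 - 1))^-1.
Definition rad_Y1 : R := (Q * (Q ^+ 2 - 1))^-1.
Definition rad_Y2 : R := (Q ^+ 3 * (Q ^+ 2 - 1))^-1.

Record Y31e1_point (pi2 : C) := Y31e1Point {
  Y_pt :> lubin_tate_point pi2;
  Y_u  : v (pt_u Y_pt) = rad_u%:E;
  Y_X1 : v (pt_X1 Y_pt) = rad_X1%:E;
  Y_X2 : v (pt_X2 Y_pt) = rad_X2%:E;
  Y_Y1 : v (pt_Y1 Y_pt) = rad_Y1%:E;
  Y_Y2 : v (pt_Y2 Y_pt) = rad_Y2%:E }.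

(* Each condition v(z) = r is v(z) >= r together with v(z^-1) >= -r, so the
   ten functions z, z^-1 (z = u, X1, X2, Y1, Y2) embed the affinoid as a closed
   subspace of a polydisc. *)
Definition Y_coord pi2 (k : 'I_5) (P : Y31e1_point pi2) : C :=
  [tuple pt_u P; pt_X1 P; pt_X2 P; pt_Y1 P; pt_Y2 P]`_k.
Definition Y_rad (k : 'I_5) : R :=
  [tuple rad_u; rad_X1; rad_X2; rad_Y1; rad_Y2]`_k.

Definition Y_gen pi2 (i : 'I_5 * bool) (P : Y31e1_point pi2) : C :=
  if i.2 then (Y_coord i.1 P)^-1 else Y_coord i.1 P.
Definition Y_genrad (i : 'I_5 * bool) : R :=
  if i.2 then - Y_rad i.1 else Y_rad i.1.

Lemma Y_coordP pi2 k (P : Y31e1_point pi2) : v (Y_coord k P) = (Y_rad k)%:E.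
Proof.
case: k => [[|[|[|[|[|//]]]]] hk]; rewrite /Y_coord /Y_rad /=.
- exact: Y_u.
- exact: Y_X1.
- exact: Y_X2.
- exact: Y_Y1.
- exact: Y_Y2.
Qed.

Lemma Y_gen_ge pi2 i (P : Y31e1_point pi2) :
  ((Y_genrad i)%:E <= v (Y_gen i P))%E.
Proof.
rewrite /Y_genrad /Y_gen; case: i => k [] /=; last by rewrite Y_coordP.
by rewrite (valV (Y_coordP k P)).
Qed.

Definition Y31e1 (pi2 : C) : presentation v := Presentation (@Y_gen_ge pi2).

End LubinTate.

(* k[x, y] is {poly {poly k}}, with x the inner and y the outer variable. *)
Definition curve_eq (k : fieldType) (q : nat) : {poly {poly k}} :=
  let x := 'X%:P in let y := 'X in
  - (x ^+ q * y ^+ (q ^ 2)) + x * y ^+ (q ^ 3) - 1.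

Definition curve_ring (k : fieldType) (q : nat) := quot_by (curve_eq k q).
HB.instance Definition _ k q := GRing.ComPzRing.on (curve_ring k q).

Definition curve_scalar (k : fieldType) (q : nat) (a : k) : curve_ring k q :=
  quot_by_pi (curve_eq k q) a%:P%:P.

(* Main.v *)
From HB Require Import structures.
From mathcomp Require Import all_boot all_order all_algebra all_field.
From mathcomp Require Import boolp classical_sets functions reals ereal.
From mathcomp Require Import ring lra zify.
Require Import Defs.

(** Write W for the valuation ring of C and k for its residue field. Choose beta
    with beta^(q^3+q^2) = pi2, so v(beta) = 1/(q^3(q^2-1)), and rescale: x = X2 /
    beta^(q^2), y = Y2 / beta, y1 = Y1 / beta^(q^2). On the affinoid, [pi]_u(Y2) = Y1
    has the dominant term Y2^(q^2), so y1 = y^(q^2) modulo beta, and in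
    mu2(X2, Y2) = pi2 the terms X1 Y2^q and X1^q Y2 are dominated, so
    - x^q y1 + x y1^q = 1 modulo beta. Together these are the equation of the curve
    (cong_curve). The remaining coordinates u and X1, and the inverses of all
    coordinates, are polynomials in x and y modulo beta as well, because x and y are
    invertible on the curve. Hence every function of residue norm at most 1 is,
    modulo beta, a polynomial in x and y over W (unit_ball_rep).

    Two facts are needed to conclude that reducing the coefficients of such a
    polynomial identifies the reduction of the affinoid with the ring of the curve.

    First, every k-point of the curve is the reduction of a point of the affinoid
    (curve_point_lift). Moore determinants parametrize the points: X1 determines u,
    and then X2, Y1 and Y2 are arbitrary roots of additive equations, the torsion
    conditions being automatic (moore_torsion). All equations have coefficients in
    the algebraic closure of F, so their roots exist, and the given (x0, y0)
    prescribes X1 and X2.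

    Second, the Nullstellensatz holds for the curve (curve_nullstellensatz). In the
    coordinate w = x y^q, its equation is w^q - y^(q^3-q) w + 1 = 0, monic in w with
    q distinct roots for each y <> 0. So a normal form of degree less than q in w
    that vanishes at all points is 0. With the lifting of points, a polynomial over W
    whose values on the affinoid are small reduces to 0 in the ring of the curve.

    The definition of the reduction refers to power-bounded functions, not to the
    unit ball of the residue norm. A power-bounded function has integral values; and
    if a function of residue norm at most 1 has values divisible by beta, then it is
    divisible by beta in the unit ball (small_values_cong), as one sees by dividing
    its normal form by its content. Applied to beta^m f, this shows that a
    power-bounded f lies in the unit ball (unit_ball_integral). *)

Set Implicit Arguments.
Unset Strict Implicit.
Unset Printing Implicit Defensive.

Import Order.TTheory GRing.Theory Num.Theory.
Local Open Scope ring_scope.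

(** * Valuations and functions on affinoids *)

Section Valuation.
Variables (R : realType) (K : fieldType) (v : valuation R K).

Lemma val_exp x (r : R) n : v x = r%:E -> v (x ^+ n) = (r *+ n)%:E.
Proof.
move=> h; elim: n => [|n IH]; first by rewrite expr0 mulr0n val1.
by rewrite exprS mulrS valM h IH.
Qed.

Lemma val_neq0 x (r : R) : v x = r%:E -> x != 0.
Proof. by move=> h; apply/eqP => x0; move: h; rewrite x0 val0. Qed.

(** This is why power-bounded functions take integral values: the powers of an
    element of negative valuation have valuations tending to - oo. *)
Lemma val_ge0_of_pow x M : (forall k, (M%:E <= v (x ^+ k)%R)%E) -> (0 <= v x)%E.
Proof.
move=> h; have [->|/(val_fin v)[r hr]] := eqVneq x 0; first by rewrite val0 leey.
rewrite hr lee_fin leNgt; apply/negP => r0.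
have [n hn] : exists n : nat, `|M| / - r < n%:R.
  exists (Num.bound (`|M| / - r)); apply: archi_boundP.
  by rewrite divr_ge0 // oppr_ge0 ltW.
have := h n; rewrite (val_exp _ hr) lee_fin => hM.
move: hn; rewrite ltr_pdivrMr ?oppr_gt0 // mulrN mulr_natl => hn.
have : - `|M| <= M by rewrite lerNl -normrN ler_norm.
by move: hM hn; clear; move=> *; lra.
Qed.

End Valuation.

Section Presentation.
Variables (R : realType) (K : fieldType) (v : valuation R K).
Variable X : presentation v.
Implicit Types (f g : pts X -> K) (t : pts X) (M B : R).

Lemma residue_ge_val M f t : residue_ge M f -> (M%:E <= v (f t))%E.
Proof.
move=> [c [[_ hs] hg]]; have [N /(_ N (leqnn N)) hN] := hs t M.
by rewrite -[f t](subrK (psum c N t)); apply: val_leD => //; exact: psum_ge.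
Qed.

Lemma residue_geZ M f (a : K) (r : R) : (r%:E <= v a)%E -> residue_ge M f ->
  residue_ge (r + M) ((fun=> a) * f).
Proof. by move=> ha; apply: residue_geM; exact: residue_ge_cst. Qed.

Lemma residue_ge_gen i : residue_ge (rad i) (@gen _ _ _ X i).
Proof.
pose e : {ffun idx X -> nat} := [ffun k => (k == i) : nat].
have we : weight e = rad i.
  rewrite /weight (bigD1 i) //= ffunE eqxx mulr1n big1 ?addr0 // => k /negbTE h.
  by rewrite ffunE h.
have de : mdeg e = 1%N.
  rewrite /mdeg (bigD1 i) //= ffunE eqxx big1 ?addn0 // => k /negbTE h.
  by rewrite ffunE h.
exists (fun n => (n == e)%:R); split; last first.
  move=> n; case: eqP => [->|_] /=; last by rewrite val0 addye ?leey.
  by rewrite val1 add0e we.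
split=> [B|t B].
  exists 2%N => n hn; case: eqP => [h|_]; last by rewrite val0 addye ?leey.
  by move: hn; rewrite h de.
exists 2%N => N hN; rewrite /psum (bigD1_seq e) ?box_uniq //=; last first.
  rewrite mem_box; apply/forallP => k; rewrite ffunE.
  by case: (k == i); lia.
rewrite eqxx mul1r big1 => [|n /negbTE ->]; last by rewrite mul0r.
rewrite addr0 /monom (bigD1 i) //= ffunE eqxx expr1 big1 ?mulr1.
  by rewrite subrr val0 leey.
by move=> k /negbTE h; rewrite ffunE h expr0.
Qed.

(** The tail of the series is represented by coefficients that vanish in the box,
    hence is again the sum of a series. *)
Lemma psum_trunc (c : {ffun idx X -> nat} -> K) N L t : (N <= L)%N ->
  psum c L t =
    psum c N t + psum (fun n => if n \in box X N then 0 else c n) L t.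
Proof.
move=> hNL; rewrite /psum (bigID (fun n => n \in box X N)) /=; congr (_ + _).
  rewrite -big_filter; apply: perm_big; apply: uniq_perm.
  - by rewrite filter_uniq ?box_uniq.
  - exact: box_uniq.
  move=> n; rewrite mem_filter andb_idr // !mem_box => /forallP h.
  by apply/forallP => i; exact: leq_trans (h i) hNL.
rewrite [RHS](bigID (fun n => n \in box X N)) /= [X in _ = X + _]big1 ?add0r.
  by apply: eq_bigr => n /negbTE ->.
by move=> n ->; rewrite mul0r.
Qed.

(** The tail of a strictly convergent series has small Gauss norm, so cutting the
    series off reduces questions about analytic functions, up to a small residue
    norm, to polynomials in the generators. *)
Lemma residue_ge_truncate M B f : residue_ge M f ->
  exists (c : {ffun idx X -> nat} -> K) N, gauss_ge c M /\ residue_ge B (f - psum c N).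
Proof.
move=> [c [[sc hc] gc]]; have [N hN] := sc B; exists c, N; split=> //.
exists (fun n => if n \in box X N then 0 else c n); split; last first.
  move=> n; case: ifP => [_|/negbT /mdeg_out /hN //].
  by rewrite val0 addye ?leey.
split=> [B'|t B'].
  have [N' h'] := sc B'; exists N' => n hn; case: ifP => _; last exact: h'.
  by rewrite val0 addye ?leey.
have [N' h'] := hc t B'; exists (maxn N N') => L.
rewrite geq_max => /andP[hNL /h'].
have -> : (f - psum c N) t = f t - psum c N t by [].
by rewrite (psum_trunc c t hNL) opprD addrA.
Qed.

Lemma residue_ge_exp M f k : residue_ge M f -> residue_ge (M *+ k) (f ^+ k).
Proof.
move=> h; elim: k => [|k IH].
  by rewrite expr0 mulr0n; apply: residue_ge_cst; rewrite val1.
by rewrite exprS mulrS; exact: residue_geM.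
Qed.

Lemma residue_ge_power_bounded f : residue_ge 0 f -> power_bounded f.
Proof.
move=> h; split; first exact: residue_ge_analytic h.
by exists 0 => k; have := residue_ge_exp k h; rewrite mul0rn.
Qed.

Lemma residue_ge_top_nilpotent M f : 0 < M -> residue_ge M f -> top_nilpotent f.
Proof.
move=> M0 h; split; first exact: residue_ge_analytic h.
move=> B; have [k0 hk0] : exists k0 : nat, `|B| / M < k0%:R.
  by exists (Num.bound (`|B| / M)); apply: archi_boundP; rewrite divr_ge0 // ltW.
exists k0 => k hk; apply: residue_geW (residue_ge_exp k h).
move: hk0; rewrite ltr_pdivrMr // mulr_natl => hk0.
apply: le_trans (ler_norm B) _; apply: le_trans (ltW hk0) _.
by rewrite ler_wpMn2l // ltW.
Qed.

Lemma fct_exprE f k t : (f ^+ k) t = f t ^+ k.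
Proof. by elim: k => [|k IH]; rewrite ?expr0 // !exprS -IH. Qed.

Lemma power_bounded_val f t : power_bounded f -> (0 <= v (f t))%E.
Proof.
move=> [_ [M hM]]; apply: (@val_ge0_of_pow _ _ _ _ M) => k.
by rewrite -fct_exprE; exact: residue_ge_val.
Qed.

Lemma top_nilpotent_val f t : top_nilpotent f -> (0 < v (f t))%E.
Proof.
move=> [_ /(_ 1)[k hk]]; have /(residue_ge_val t) := hk k (leqnn k).
rewrite fct_exprE; have [->|/(val_fin v)[r hr]] := eqVneq (f t) 0.
  by rewrite val0 ltry.
rewrite hr (val_exp _ hr) lee_fin lte_fin => h1; rewrite ltNge.
apply/negP => r0; have : r *+ k <= 0 by rewrite mulrn_wle0.
by move=> h2; have := le_trans h1 h2; rewrite ler10.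
Qed.

End Presentation.

Section ValuationRing.
Variables (R : realType) (K : fieldType) (v : valuation R K).

Lemma vring_val_zmod : zmod_morphism (@vring_val R K v).
Proof. exact: (rmorphB (val : vring v -> K)). Qed.
Lemma vring_val_monoid : monoid_morphism (@vring_val R K v).
Proof.
by split; [exact: (rmorph1 (val : vring v -> K))
          |exact: (rmorphM (val : vring v -> K))].
Qed.
HB.instance Definition _ :=
  GRing.isZmodMorphism.Build (vring v) K (@vring_val R K v) vring_val_zmod.
HB.instance Definition _ :=
  GRing.isMonoidMorphism.Build (vring v) K (@vring_val R K v) vring_val_monoid.

Lemma vring_valD (a b : vring v) : vring_val (a + b) = vring_val a + vring_val b.
Proof. exact: rmorphD. Qed.
Lemma vring_valB (a b : vring v) : vring_val (a - b) = vring_val a - vring_val b.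
Proof. exact: rmorphB. Qed.
Lemma vring_valN (a : vring v) : vring_val (- a) = - vring_val a.
Proof. exact: rmorphN. Qed.
Lemma vring_valM (a b : vring v) : vring_val (a * b) = vring_val a * vring_val b.
Proof. exact: rmorphM. Qed.
Lemma vring_valX (a : vring v) n : vring_val (a ^+ n) = vring_val a ^+ n.
Proof. exact: rmorphXn. Qed.
Lemma vring_val0 : vring_val (0 : vring v) = 0. Proof. exact: rmorph0. Qed.
Lemma vring_val1 : vring_val (1 : vring v) = 1. Proof. exact: rmorph1. Qed.
Definition vring_valE :=
  (vring_valD, vring_valB, vring_valN, vring_valM, vring_valX, vring_val0, vring_val1).

Lemma vring_val_inj : injective (@vring_val R K v).
Proof. exact: (@val_inj _ _ (vring v)). Qed.

Lemma residue_field_pchar p : p \in [pchar K] -> p \in [pchar residue_field v].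
Proof.
move=> charK; rewrite inE (pcharf_prime charK) /= -(rmorph_nat (residue v)).
have -> : p%:R = 0 :> vring v.
  by apply: vring_val_inj; rewrite rmorph_nat vring_val0 (pcharf0 charK).
by rewrite rmorph0.
Qed.

End ValuationRing.

Section Quotients.
Variables (R : realType) (K : fieldType) (v : valuation R K).
Variable X : presentation v.

Lemma pb_funB (f g : pb_ring X) : pb_fun (f - g) = pb_fun f - pb_fun g.
Proof. exact: (rmorphB (val : pb_ring X -> (pts X -> K))). Qed.
Lemma pb_funM (f g : pb_ring X) : pb_fun (f * g) = pb_fun f * pb_fun g.
Proof. exact: (rmorphM (val : pb_ring X -> (pts X -> K))). Qed.
Lemma pb_fun1 : pb_fun (1 : pb_ring X) = 1.
Proof. exact: (rmorph1 (val : pb_ring X -> (pts X -> K))). Qed.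

Lemma reduce_eq (f g : pb_ring X) :
  reduce X f = reduce X g <-> top_nilpotent (pb_fun f - pb_fun g).
Proof.
by rewrite -pb_funB; split=> [/ring_quot_piP/asboolP|h]; [|apply/ring_quot_piP/asboolP].
Qed.

Lemma reduceK (x : reduction X) : reduce X (repr x) = x.
Proof. exact: ring_quot_piK. Qed.

Lemma quot_by_eq0 (A : comPzRingType) (f h : A) :
  quot_by_pi f h = 0 <-> exists g, h = g * f.
Proof.
rewrite -(rmorph0 (quot_by_pi f)); split=> [/ring_quot_piP|e].
  by rewrite subr0 => /asboolP.
by apply/ring_quot_piP; rewrite subr0; apply/asboolP.
Qed.

Lemma quot_byK (A : comPzRingType) (f : A) (x : quot_by f) : quot_by_pi f (repr x) = x.
Proof. exact: ring_quot_piK. Qed.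

End Quotients.

(** * The curve - x^q y^(q^2) + x y^(q^3) = 1 *)

Section Trinomial.
Variables (A : comNzRingType) (q : nat) (a c : A).
Hypothesis q1 : (1 < q)%N.

Lemma trinomial_tail_size : (size (a *: 'X + c%:P)%R < size ('X^q : {poly A}))%N.
Proof.
rewrite size_polyXn; apply: leq_ltn_trans (size_polyD _ _) _; rewrite gtn_max.
rewrite (leq_ltn_trans (size_scale_leq _ _)) ?size_polyX ?size_polyC //.
by case: eqP; lia.
Qed.

Lemma trinomial_monic : 'X^q + (a *: 'X + c%:P) \is monic.
Proof. by rewrite monicE lead_coefDl ?lead_coefXn ?trinomial_tail_size. Qed.

Lemma size_trinomial : size ('X^q + (a *: 'X + c%:P)) = q.+1.
Proof. by rewrite size_polyDl ?trinomial_tail_size // size_polyXn. Qed.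

Lemma horner_trinomial z : ('X^q + (a *: 'X + c%:P)).[z] = z ^+ q + (a * z + c).
Proof. by rewrite hornerD hornerXn hornerD hornerZ hornerX hornerC. Qed.

End Trinomial.

Section CurvePolynomial.
Variables (A : comNzRingType) (q : nat).

(** {poly {poly A}} stands for A[x, y], with x the inner and y the outer
    variable. *)
Definition ev2 (x y : A) (G : {poly {poly A}}) : A := G.[y%:P].[x].

Lemma ev2D x y G H : ev2 x y (G + H) = ev2 x y G + ev2 x y H.
Proof. by rewrite /ev2 !hornerD. Qed.
Lemma ev2B x y G H : ev2 x y (G - H) = ev2 x y G - ev2 x y H.
Proof. by rewrite /ev2 !hornerE. Qed.
Lemma ev2M x y G H : ev2 x y (G * H) = ev2 x y G * ev2 x y H.
Proof. by rewrite /ev2 !hornerM. Qed.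
Lemma ev2C x y a : ev2 x y a%:P%:P = a.
Proof. by rewrite /ev2 !hornerC. Qed.
Lemma ev2Cp x y p : ev2 x y p%:P = p.[x].
Proof. by rewrite /ev2 hornerC. Qed.
Lemma ev2X x y : ev2 x y 'X%:P = x.
Proof. by rewrite ev2Cp hornerX. Qed.
Lemma ev2Y x y : ev2 x y 'X = y.
Proof. by rewrite /ev2 hornerX hornerC. Qed.
Lemma ev2_exp x y G n : ev2 x y (G ^+ n) = ev2 x y G ^+ n.
Proof. by rewrite /ev2 !horner_exp. Qed.

Definition curve_poly : {poly {poly A}} :=
  let x := 'X%:P in let y := 'X in
  - (x ^+ q * y ^+ (q ^ 2)) + x * y ^+ (q ^ 3) - 1.

Lemma ev2_curve x y :
  ev2 x y curve_poly = - (x ^+ q * y ^+ (q ^ 2)) + x * y ^+ (q ^ 3) - 1.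
Proof.
rewrite /curve_poly ev2B -[1 in LHS]/(1%:P%:P) ev2C ev2D -sub0r ev2B.
by rewrite -[0 in LHS]/(0%:P%:P) ev2C sub0r !ev2M !ev2_exp ev2X ev2Y.
Qed.

(** The substitution w = x y^q, from A[y, w] (w the outer variable) to A[x, y]. *)
Definition wsubst (T : {poly {poly A}}) : {poly {poly A}} :=
  (map_poly (map_poly polyC) T).['X%:P * 'X ^+ q].

Lemma wsubstD S T : wsubst (S + T) = wsubst S + wsubst T.
Proof. by rewrite /wsubst rmorphD hornerD. Qed.
Lemma wsubstM S T : wsubst (S * T) = wsubst S * wsubst T.
Proof. by rewrite /wsubst rmorphM hornerM. Qed.
Lemma wsubstX : wsubst 'X = 'X%:P * 'X ^+ q.
Proof. by rewrite /wsubst map_polyX hornerX. Qed.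
Lemma wsubstC p : wsubst p%:P = map_poly polyC p.
Proof. by rewrite /wsubst map_polyC hornerC. Qed.
Lemma wsubst_exp T n : wsubst (T ^+ n) = wsubst T ^+ n.
Proof. by rewrite /wsubst rmorphXn horner_exp. Qed.
Lemma wsubst_Xn n : wsubst ('X^n)%:P = 'X^n.
Proof. by rewrite wsubstC map_polyXn. Qed.

Lemma poly2_ind (S : {poly {poly A}} -> Prop) :
  (forall a, S a%:P%:P) -> S 'X%:P -> S 'X ->
  (forall G H, S G -> S H -> S (G + H)) ->
  (forall G H, S G -> S H -> S (G * H)) -> forall G, S G.
Proof.
move=> hC hX hY hD hM; elim/poly_ind => [|G c IH]; first exact: hC 0.
apply: (hD); first exact: hM.
elim/poly_ind: c => [|c a IHc]; first exact: hC 0.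
by rewrite polyCD polyCM; apply: (hD); [exact: hM | exact: hC].
Qed.

Lemma ev2_wsubst x y T : ev2 x y (wsubst T) = T.[(x * y ^+ q)%:P].[y].
Proof.
elim/poly2_ind: T => [a||||].
- by rewrite wsubstC map_polyC ev2C !hornerC.
- by rewrite wsubstC map_polyX ev2Y !(hornerC, hornerX).
- by rewrite wsubstX ev2M ev2_exp ev2X ev2Y hornerX hornerC.
- by move=> S T hS hT; rewrite wsubstD ev2D !hornerD hS hT.
- by move=> S T hS hT; rewrite wsubstM ev2M !hornerM hS hT.
Qed.

(** The equation of the curve, up to sign, in the coordinates w and y. *)
Definition wcurve : {poly {poly A}} := 'X^q + (- 'X^(q ^ 3 - q) *: 'X + 1%:P).

Hypothesis q1 : (1 < q)%N.

Lemma wsubstN T : wsubst (- T) = - wsubst T.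
Proof. by rewrite /wsubst rmorphN hornerN. Qed.
Lemma wsubst1 : wsubst 1 = 1.
Proof. by rewrite /wsubst rmorph1 hornerC. Qed.

Lemma wsubst_wcurve : wsubst wcurve = - curve_poly.
Proof.
rewrite /wcurve /curve_poly -mul_polyC polyC1 !wsubstD wsubst1 wsubstM wsubst_exp.
rewrite polyCN wsubstN wsubst_Xn wsubstX exprMn -exprM mulnn.
have -> : (q ^ 3 = q ^ 3 - q + q)%N.
  by rewrite subnK // -{1}[q]expn1 leq_exp2l.
rewrite exprD addnK; set z := 'X^(q ^ 3 - q); set z2 := 'X^(q ^ 2).
by set z1 := 'X^q; set x := 'X%:P; ring.
Qed.

Definition wsubst_up_to_y (G : {poly {poly A}}) :=
  exists N T, 'X ^+ N * G = wsubst T.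

Lemma wsubst_up_to_yD G H :
  wsubst_up_to_y G -> wsubst_up_to_y H -> wsubst_up_to_y (G + H).
Proof.
move=> [N [S hS]] [M [T hT]].
exists (N + M)%N, (('X^M)%:P * S + ('X^N)%:P * T).
by rewrite wsubstD !wsubstM !wsubst_Xn -hS -hT exprD; ring.
Qed.

Lemma wsubst_up_to_yM G H :
  wsubst_up_to_y G -> wsubst_up_to_y H -> wsubst_up_to_y (G * H).
Proof.
move=> [N [S hS]] [M [T hT]]; exists (N + M)%N, (S * T).
by rewrite wsubstM -hS -hT exprD; ring.
Qed.

(** Only x needs a power of y, since x y^q = w. *)
Lemma wsubst_up_to_yT G : wsubst_up_to_y G.
Proof.
elim/poly2_ind: G => [a|||G H|G H].
- by exists 0%N, a%:P%:P; rewrite expr0 mul1r wsubstC map_polyC.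
- by exists q, 'X; rewrite wsubstX mulrC.
- by exists 0%N, 'X%:P; rewrite expr0 mul1r wsubstC map_polyX.
- exact: wsubst_up_to_yD.
- exact: wsubst_up_to_yM.
Qed.

(** In terms of w = x y^q the equation of the curve is monic of degree q in w,
    and x is w up to a power of y. So, after multiplication by a power of y, a
    polynomial can be divided with remainder by the equation, over any ring. *)
Lemma curve_normal_form (G : {poly {poly A}}) : exists N T H,
  'X ^+ N * G = wsubst T + H * curve_poly /\ (size T <= q)%N.
Proof.
have [N [T hT]] := wsubst_up_to_yT G.
have Wm : wcurve \is monic by exact: trinomial_monic.
exists N, (Pdiv.Ring.rmodp T wcurve), (- wsubst (Pdiv.Ring.rdivp T wcurve)).
rewrite {1}hT {1}(Pdiv.RingMonic.rdivp_eq Wm T); split.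
  by rewrite wsubstD wsubstM wsubst_wcurve; ring.
have := Pdiv.Ring.ltn_rmodpN0 T (monic_neq0 Wm).
by rewrite [size wcurve]size_trinomial.
Qed.

(** The equation reads y (x y^(q^3-1) - x^q y^(q^2-1)) = 1: y is invertible on the
    curve, which undoes the multiplications by powers of y. *)
Lemma curve_y_unit : 'X * ('X%:P * 'X ^+ (q ^ 3).-1 - 'X%:P ^+ q * 'X ^+ (q ^ 2).-1)
  = 1 + curve_poly.
Proof.
have h n : 'X * 'X ^+ (q ^ n).-1 = 'X ^+ (q ^ n) :> {poly {poly A}}.
  by rewrite -exprS prednK // expn_gt0 ltnW.
rewrite mulrBr !(mulrCA 'X) !h /curve_poly.
by move: ('X^(q ^ 3)) ('X^(q ^ 2)) ('X%:P) => a b c; ring.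
Qed.

End CurvePolynomial.

Section BaseChange.
Variables (A B : comNzRingType) (phi : {rmorphism A -> B}).

Definition map_poly2 : {rmorphism {poly {poly A}} -> {poly {poly B}}} :=
  map_poly (map_poly phi).
Local Notation red := map_poly2.

Lemma map_poly2C a : red a%:P%:P = (phi a)%:P%:P.
Proof. by rewrite /red /= map_polyC /= map_polyC. Qed.
Lemma map_poly2X : red 'X%:P = 'X%:P.
Proof. by rewrite /red /= map_polyC /= map_polyX. Qed.
Lemma map_poly2Y : red 'X = 'X.
Proof. exact: map_polyX. Qed.
Lemma map_poly2_coef G i m : (red G)`_i`_m = phi G`_i`_m.
Proof. by rewrite /red /= coef_map /= coef_map. Qed.

Lemma map_poly2_curve q : red (curve_poly A q) = curve_poly B q.
Proof.
rewrite /curve_poly rmorphB rmorphD rmorphN (rmorphM red) (rmorphM red).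
by rewrite !(rmorphXn red) map_poly2X map_poly2Y rmorph1.
Qed.

Lemma ev2_map x y G : phi (ev2 x y G) = ev2 (phi x) (phi y) (red G).
Proof.
elim/poly2_ind: G => [a|||G H hG hH|G H hG hH].
- by rewrite map_poly2C !ev2C.
- by rewrite map_poly2X !ev2X.
- by rewrite map_poly2Y !ev2Y.
- by rewrite ev2D rmorphD hG hH (rmorphD red) ev2D.
- by rewrite ev2M rmorphM hG hH (rmorphM red) ev2M.
Qed.

Lemma map_poly2_wsubst q S : red (wsubst q S) = wsubst q (red S).
Proof.
elim/poly2_ind: S => [a|||G H hG hH|G H hG hH].
- by rewrite map_poly2C !wsubstC !map_polyC map_poly2C.
- by rewrite map_poly2X !wsubstC !map_polyX map_poly2Y.
- by rewrite map_poly2Y !wsubstX (rmorphM red) (rmorphXn red) map_poly2X map_poly2Y.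
- by rewrite wsubstD (rmorphD red) hG hH (rmorphD red) wsubstD.
- by rewrite wsubstM (rmorphM red) hG hH (rmorphM red) wsubstM.
Qed.

Lemma ev2_map_wsubst q x y S :
  (red S).[(phi x * phi y ^+ q)%:P].[phi y] = phi (ev2 x y (wsubst q S)).
Proof. by rewrite -ev2_wsubst -map_poly2_wsubst ev2_map. Qed.

Lemma map_poly2_lift (H : {poly {poly B}}) :
  (forall c, exists a, phi a = c) -> exists G, red G = H.
Proof.
move=> surj; elim/poly2_ind: H => [c|||G H [G' hG] [H' hH]|G H [G' hG] [H' hH]].
- by have [a ha] := surj c; exists a%:P%:P; rewrite map_poly2C ha.
- by exists 'X%:P; exact: map_poly2X.
- by exists 'X; exact: map_poly2Y.
- by exists (G' + H'); rewrite (rmorphD red) hG hH.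
- by exists (G' * H'); rewrite (rmorphM red) hG hH.
Qed.

End BaseChange.

Lemma map_poly2_content (A : comNzRingType) (B : idomainType)
    (phi : {rmorphism A -> B}) a S :
  map_poly2 phi (a%:P%:P * S) = 0 -> map_poly2 phi S != 0 -> phi a = 0.
Proof.
rewrite (rmorphM (map_poly2 phi)) map_poly2C => /eqP; rewrite mulf_eq0 !polyC_eq0.
by case/orP=> [/eqP|->].
Qed.

Section Nullstellensatz.
Variables (k : fieldType) (q : nat).
Hypothesis q1 : (1 < q)%N.
Hypothesis q0 : q%:R = 0 :> k.
(* k is algebraically closed *)
Hypothesis ksplit : forall P : {poly k}, P \is monic ->
  exists rs : seq k, P = \prod_(r <- rs) ('X - r%:P).

Lemma split_root (P : {poly k}) : (1 < size P)%N -> exists z, root P z.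
Proof.
move=> hP; have P0 : lead_coef P != 0.
  by rewrite lead_coef_eq0 -size_poly_gt0 ltnW.
have hm : (lead_coef P)^-1 *: P \is monic by rewrite monicE lead_coefZ mulVf.
have [rs hrs] := ksplit hm.
have : (1 < size ((lead_coef P)^-1 *: P))%N by rewrite size_scale ?invr_eq0.
case: rs hrs => [|r rs] hrs; first by rewrite hrs big_nil size_poly1.
move=> _; exists r; rewrite -(rootZ r _ (invr_neq0 P0)) hrs.
by rewrite root_prod_XsubC mem_head.
Qed.

(** k is infinite: if z P(z) vanished for all z and P were not 0, then z P(z) + 1
    would be a nonconstant polynomial without root. *)
Lemma poly_vanish (P : {poly k}) : (forall z, z != 0 -> P.[z] = 0) -> P = 0.
Proof.
move=> h; apply/eqP/negPn/negP => P0.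
have sP : (1 < size (P * 'X)%R)%N by rewrite (size_mulX P0) ltnS size_poly_gt0.
have [z] : exists z, root (P * 'X + 1%:P) z.
  apply: split_root; rewrite size_polyDl // size_polyC oner_neq0.
  exact: sP.
rewrite /root hornerD hornerC hornerMX.
have [->|/h ->] := eqVneq z 0; first by rewrite mulr0 add0r oner_eq0.
by rewrite mul0r add0r oner_eq0.
Qed.

(** The derivative in w of the equation is the nonzero constant - s, because
    q = 0 in k; so the fibre over each y <> 0, where s = y^(q^3-q), has q points. *)
Lemma wfibre (s : k) : s != 0 -> exists rs : seq k,
  [/\ uniq rs, size rs = q & forall w, w \in rs -> w ^+ q - s * w + 1 = 0].
Proof.
move=> s0; pose P : {poly k} := 'X^q + (- s *: 'X + 1%:P).
have [rs hrs] := ksplit (trinomial_monic (- s) 1 q1 : P \is monic).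
exists rs; split.
- rewrite -separable_prod_XsubC -hrs unlock.
  have -> : P^`() = (- s)%:P.
    rewrite /P !derivE -mulr_natl -polyC_natr q0 mul0r add0r addr0.
    by rewrite alg_polyC.
  by rewrite -[_%:P]mulr1 mul_polyC coprimepZr ?oppr_eq0 // coprimep1.
- by have := size_trinomial (- s) 1 q1; rewrite -/P hrs size_prod_XsubC => -[].
move=> w hw; have : root P w by rewrite hrs root_prod_XsubC.
by rewrite /root horner_trinomial addrA mulNr => /eqP.
Qed.

(** A polynomial of degree less than q in w that vanishes on the curve vanishes
    at q values of w for each y <> 0, hence identically. *)
Lemma wpoly_vanish (T : {poly {poly k}}) : (size T <= q)%N ->
  (forall x y, ev2 x y (curve_poly k q) = 0 -> T.[(x * y ^+ q)%:P].[y] = 0) ->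
  T = 0.
Proof.
move=> sT h; apply/polyP => i; rewrite coef0; apply: poly_vanish => y y0.
have [rs [urs srs hrs]] := wfibre (expf_neq0 (q ^ 3 - q) y0).
suff /polyP/(_ i) : map_poly (horner_eval y) T = 0.
  by rewrite coef_map coef0.
apply: (roots_geq_poly_eq0 _ urs); last first.
  by rewrite srs (leq_trans (size_poly _ _)).
apply/allP => w /hrs hw; apply/eqP.
have -> : w = horner_eval y w%:P by rewrite /horner_eval hornerC.
rewrite horner_map /= /horner_eval.
have yq : y ^+ q != 0 by rewrite expf_neq0.
have := h (w / y ^+ q) y; rewrite divfK //; apply.
rewrite ev2_curve -(oppr0 k) -hw expr_div_n -exprM mulnn divfK ?expf_neq0 //.
have e : (q ^ 3 = q + (q ^ 3 - q))%N.
  by rewrite subnKC // -{1}[q]expn1 leq_exp2l.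
by rewrite {1}e exprD mulrA divfK //; ring.
Qed.

(** Nullstellensatz for the curve: its normal form vanishes on the curve, so it
    is 0, and y is invertible modulo the equation. *)
Lemma curve_nullstellensatz (G : {poly {poly k}}) :
  (forall x y, ev2 x y (curve_poly k q) = 0 -> ev2 x y G = 0) ->
  exists H, G = H * curve_poly k q.
Proof.
move=> h; have [N [T [H [e sT]]]] := curve_normal_form q1 G.
have T0 : T = 0.
  apply: wpoly_vanish => // x y hxy; rewrite -ev2_wsubst.
  have : ev2 x y ('X^N * G) = 0 by rewrite ev2M h ?mulr0.
  by rewrite e ev2D ev2M hxy mulr0 addr0.
move: e; rewrite T0 -[0]/(0%:P) wsubstC rmorph0 add0r.
set f := curve_poly k q.
elim: N H => [|N IH] H; first by rewrite expr0 mul1r; exists H.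
set z : {poly {poly k}} := 'X%:P * 'X ^+ (q ^ 3).-1 - 'X%:P ^+ q * 'X ^+ (q ^ 2).-1.
have hz : 'X * z = 1 + f by exact: curve_y_unit.
move=> e; apply: (IH (z * H - 'X^N * G)).
have {}e : 'X * z * ('X^N * G) = z * H * f.
  by rewrite -[RHS]mulrA -e exprS; move: ('X^N) z {hz} => a b; ring.
move: e; rewrite hz => e; rewrite mulrBl -e; ring.
Qed.

End Nullstellensatz.

(** * Polynomials over a valuation ring *)

Section PolynomialReduction.
Variables (R : realType) (K : fieldType) (v : valuation R K).
Local Notation W := (vring v).
Local Notation k := (residue_field v).

Local Notation red := (map_poly2 (residue v)).

Lemma seq_val_min (s : seq W) : s != [::] -> exists2 a, a \in s &
  forall c, c \in s -> (v (vring_val a) <= v (vring_val c))%E.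
Proof.
elim: s => // a [|a' s] IH _.
  by exists a; rewrite ?mem_head // => c; rewrite inE => /eqP ->.
have [m hm hmin] := IH isT.
have [le|le] := leP (v (vring_val a)) (v (vring_val m)).
  exists a; rewrite ?mem_head // => c; rewrite inE => /predU1P[-> //|hc].
  exact: le_trans le (hmin _ hc).
exists m; first by rewrite inE hm orbT.
by move=> c; rewrite inE => /predU1P[->|/hmin //]; exact: ltW.
Qed.

(** Dividing by a coefficient of least valuation makes the reduction nonzero. *)
Lemma poly_content (S : {poly {poly W}}) : S != 0 -> exists a S1,
  [/\ vring_val a != 0, S = a%:P%:P * S1 & red S1 != 0].
Proof.
move=> S0; pose s : seq W := flatten (map (@polyseq W) S).
have coef_in i m : S`_i`_m != 0 -> S`_i`_m \in s.
  move=> h; apply/flatten_mapP; exists S`_i; apply: mem_nth; rewrite ltnNge.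
    by apply: contra h => h; rewrite (nth_default 0 h) coef0.
  by apply: contra h => h; rewrite nth_default.
have lS0 : lead_coef (lead_coef S) != 0 by rewrite !lead_coef_eq0.
have lin : lead_coef (lead_coef S) \in s by exact: coef_in lS0.
have sne : s != [::] by apply/eqP => e; move: lin; rewrite e.
have [a ha amin] := seq_val_min sne.
have a0 : vring_val a != 0.
  apply/eqP => e; have := amin _ lin; rewrite e val0 leye_eq => /eqP /val_eqy e'.
  by move/eqP: lS0; apply; apply: vring_val_inj; rewrite vring_val0.
have [ra hra] := val_fin v a0.
pose dv (c : W) : W := insubd 0 (vring_val c / vring_val a).
have dvE c : c = 0 \/ c \in s -> a * dv c = c.
  move=> hc; have hi : vring_val c / vring_val a \in vint v.
    case: hc => [->|/amin hc]; first by rewrite vring_val0 mul0r rpred0.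
    rewrite unfold_in valM (valV hra).
    have [->|/(val_fin v)[rc hrc]] := eqVneq (vring_val c) 0.
      by rewrite val0 leey.
    by move: hc; rewrite hra hrc -EFinD !lee_fin subr_ge0.
  apply: vring_val_inj; rewrite vring_valM.
  have -> : vring_val (dv c) = vring_val c / vring_val a.
    exact: (insubdK (0 : W) hi).
  by rewrite mulrC divfK.
have dv0 : dv 0 = 0.
  have := dvE 0 (or_introl erefl) => /(congr1 (@vring_val _ _ _)).
  rewrite vring_valM vring_val0 => /eqP; rewrite mulf_eq0 (negbTE a0) /= => /eqP e.
  by apply: vring_val_inj; rewrite vring_val0.
have mdv0 : map_poly dv 0 = 0 by apply/polyP => i; rewrite coef_map_id0 // !coef0.
pose S1 := map_poly (map_poly dv) S.
have S1E i m : S1`_i`_m = dv S`_i`_m by rewrite /S1 !coef_map_id0.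
exists a, S1; split=> //.
  apply/polyP => i; apply/polyP => m; rewrite !coefCM S1E dvE //.
  by have [->|/coef_in h] := eqVneq S`_i`_m 0; [left|right].
have [i [m him]] : exists i m, S`_i`_m = a.
  move/flatten_mapP: ha => [c /(nthP 0)[i _ <-] /(nthP 0)[m _ <-]].
  by exists i, m.
apply/eqP => e; have := map_poly2_coef (residue v) S1 i m; rewrite e !coef0 S1E him.
have -> : dv a = 1.
  have /(congr1 (@vring_val _ _ _)) := dvE a (or_intror ha).
  rewrite vring_valM -[RHS]mulr1 => /(mulfI a0) h.
  by apply: vring_val_inj; rewrite h vring_val1.
by move/eqP; rewrite rmorph1 eq_sym oner_eq0.
Qed.

End PolynomialReduction.

(** * Cardinality of a finite residue field *)

Section ResidueCardinal.
Variables (k : fieldType) (q : nat) (e : 'I_q -> k) (e' : k -> 'I_q).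

(** A copy of k that carries the finite type structure transported from 'I_q. *)
Definition fin_field of cancel e' e : Type := k.
Variable e'K : cancel e' e.
Local Notation kf := (fin_field e'K).
HB.instance Definition _ := GRing.Field.on kf.

Lemma fin_field_pickleK :
  pcancel (fun x : kf => nat_of_ord (e' x)) (fun n => omap e (insub n)).
Proof. by move=> x; rewrite valK /= e'K. Qed.
HB.instance Definition _ := Choice_isCountable.Build kf fin_field_pickleK.
HB.instance Definition _ := isFinite.Build kf
  (pcan_enumP (can_pcan (e'K : @cancel 'I_q kf e' e))).

(** A finite field of characteristic p is a vector space over its prime field. *)
Lemma fin_field_card p : cancel e e' -> p \in [pchar k] -> p.-nat q.
Proof.
move=> eK hp; have hp' : p \in [pchar kf] by [].
have <- : #|{: kf}| = q.
  rewrite -[RHS]card_ord; apply: (@bij_eq_card kf 'I_q e').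
  by exists e.
rewrite -(_ : #|pPrimeCharType hp'| = #|{: kf}|) // card_pprimeChar.
by rewrite pnatX pnat_id ?(pcharf_prime hp).
Qed.

End ResidueCardinal.

(** * Algebraically closed valued fields *)

Section ClosedSubfield.
Variables (R : realType) (K : closedFieldType) (C : fieldType).
Variables (v : valuation R C) (j : {rmorphism K -> C}).

Lemma pullback_eqy x : v (j x) = +oo%E <-> x = 0.
Proof.
split=> [/(val_eqy v)/eqP|->]; last by rewrite rmorph0 val0.
by rewrite fmorph_eq0 => /eqP.
Qed.
Lemma pullback_neqNy x : v (j x) <> -oo%E. Proof. exact: val_neqNy. Qed.
Lemma pullbackM x y : v (j (x * y)) = (v (j x) + v (j y))%E.
Proof. by rewrite rmorphM valM. Qed.
Lemma pullbackD x y : (mine (v (j x)) (v (j y)) <= v (j (x + y)%R))%E.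
Proof. by rewrite rmorphD valD. Qed.
(** To be applied to the algebraic closure K of F inside its completion C. Points
    of the affinoid are constructed with coordinates in K, where polynomial
    equations have solutions. *)
Definition pullback : valuation R K :=
  Valuation pullback_eqy pullback_neqNy pullbackM pullbackD.

Local Notation W := (vring pullback).

Definition vring_map (a : W) : vring v := VRing (vringP a : j (vring_val a) \in vint v).

Lemma vring_map_zmod : zmod_morphism vring_map.
Proof.
by move=> a b; apply: vring_val_inj; rewrite /= !rmorphB.
Qed.
Lemma vring_map_monoid : monoid_morphism vring_map.
Proof.
split=> [|a b]; apply: vring_val_inj; rewrite /= ?rmorph1 //.
by rewrite !rmorphM.
Qed.
HB.instance Definition _ :=
  GRing.isZmodMorphism.Build W (vring v) vring_map vring_map_zmod.
HB.instance Definition _ :=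
  GRing.isMonoidMorphism.Build W (vring v) vring_map vring_map_monoid.

(** By density, K and C have the same residue field; it is taken to be that of C. *)
Definition rho : {rmorphism W -> residue_field v} := residue v \o vring_map.

(** The valuation ring is integrally closed: a root of negative valuation would make
    the leading term of a monic equation strictly dominant. *)
Lemma integral_in_vring (P : {poly W}) z : P \is monic ->
  root (map_poly (@vring_val _ _ pullback) P) z -> exists2 x : W, vring_val x = z & root P x.
Proof.
move=> Pm hz.
suff hzi : z \in vint pullback.
  exists (VRing hzi) => //; rewrite /root -(inj_eq (@vring_val_inj _ _ _)) rmorph0.
  by rewrite -horner_map.
have [->|/(val_fin pullback)[r hr]] := eqVneq z 0; first exact: rpred0.
rewrite unfold_in hr lee_fin leNgt; apply/negP => r0.
have sP : (0 < size P)%N by rewrite size_poly_gt0 monic_neq0.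
move: hz; rewrite /root horner_coef size_map_poly_id0; last first.
  by rewrite (monicP Pm) rmorph1 oner_neq0.
case E : (size P) sP => [|n] // _; rewrite big_ord_recr /=.
rewrite coef_map (_ : P`_n = 1); last by rewrite -(monicP Pm) lead_coefE E.
rewrite /= mul1r addrC addr_eq0 => /eqP hzn.
have : ((r *+ n.-1)%:E <= pullback (z ^+ n)%R)%E.
  rewrite hzn valN; apply: val_le_sum => i _; rewrite coef_map.
  rewrite -[r *+ n.-1]add0r; apply: val_leM; first exact: (vringP P`_i).
  rewrite (val_exp _ hr) lee_fin ler_wnMn2l // ?ltW //.
  by case: n {E hzn} i => [[]|n] // i; rewrite -ltnS.
rewrite (val_exp _ hr) lee_fin.
case: n E hzn => [|n] E hzn /=.
  by move: hzn; rewrite big_ord0 expr0 => /eqP; rewrite oppr0 oner_eq0.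
by rewrite mulrS; lra.
Qed.

Lemma vring_split (P : {poly W}) : P \is monic ->
  exists rs : seq W, P = \prod_(r <- rs) ('X - r%:P).
Proof.
move=> Pm; have [zs] := closed_field_poly_normal (map_poly (@vring_val _ _ pullback) P).
rewrite lead_coef_map_inj // ?(monicP Pm) ?rmorph1 ?scale1r; last exact: vring_val_inj.
move=> hzs; have hall z : z \in zs -> exists x : W, vring_val x = z.
  move=> hz; have [|x hx _] := @integral_in_vring P z Pm; last by exists x.
  by rewrite hzs root_prod_XsubC.
have [rs hrs] : exists rs : seq W, map (@vring_val _ _ pullback) rs = zs.
  elim: zs hall {hzs} => [|z zs IH] hall; first by exists [::].
  have [x hx] := hall z (mem_head _ _).
  have [|rs <-] := IH; last by exists (x :: rs); rewrite /= hx.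
  by move=> y hy; apply: hall; rewrite inE hy orbT.
exists rs; apply: (@map_inj_poly _ _ (@vring_val _ _ pullback)); [exact: vring_val_inj|exact: rmorph0|].
rewrite hzs rmorph_prod -hrs big_map; apply: eq_bigr => r _.
by rewrite rmorphB /= map_polyX map_polyC.
Qed.

(** A monic polynomial over W splits over W, so its roots reduce to all the roots,
    simple or multiple, of its reduction. *)
Lemma root_lift (P : {poly W}) x0 : P \is monic ->
  root (map_poly rho P) x0 -> exists2 x : W, root P x & rho x = x0.
Proof.
move=> Pm; have [rs ->] := vring_split Pm.
rewrite rmorph_prod.
have -> : \prod_(r <- rs) map_poly rho ('X - r%:P) =
    \prod_(r <- map rho rs) ('X - r%:P).
  rewrite big_map; apply: eq_bigr => r _.
  by rewrite rmorphB /= map_polyX map_polyC.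
rewrite root_prod_XsubC => /mapP[r hr ->]; exists r => //.
rewrite /root horner_prod; apply/eqP; rewrite (big_rem r) //=.
by rewrite !hornerE subrr mul0r.
Qed.

Hypothesis dense : forall (x : C) (M : R), exists a, (M%:E <= v (x - j a)%R)%E.

Lemma rho_surj (c : residue_field v) : exists a : W, rho a = c.
Proof.
pose z := repr c; have [a ha] := dense (vring_val z) 1.
have hi : a \in vint pullback.
  rewrite unfold_in /= -[j a]opprK -[- j a](addKr (vring_val z)) opprD opprK.
  apply: val_leB; first exact: (vringP z).
  by apply: le_trans ha; rewrite lee_fin.
exists (VRing hi); rewrite -[RHS]residueK /=; apply/eqP.
rewrite -subr_eq0 -rmorphB residue_eq0 unfold_in rmorphB /=.
by rewrite -valN opprB; apply: lt_le_trans ha; rewrite lte_fin.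
Qed.

(** The residue field is algebraically closed: lift the coefficients, split the
    lift, and reduce its roots. *)
Lemma residue_split (P : {poly residue_field v}) : P \is monic ->
  exists rs : seq (residue_field v), P = \prod_(r <- rs) ('X - r%:P).
Proof.
move=> Pm; have sP : (0 < size P)%N by rewrite size_poly_gt0 monic_neq0.
have /choice[g hg] c : exists a : W, rho a = c by exact: rho_surj.
pose n := (size P).-1; pose Q : {poly W} := 'X^n + \poly_(i < n) g P`_i.
have sQ : (size (\poly_(i < n) g P`_i)%R < n.+1)%N by rewrite ltnS size_poly.
have Qm : Q \is monic.
  by rewrite monicE lead_coefDl ?lead_coefXn // size_polyXn.
have hQ : P = map_poly rho Q.
  apply/polyP => i; have -> : (map_poly rho Q)`_i = rho Q`_i by rewrite coef_map.
  rewrite coefD coefXn coef_poly.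
  have [hi|hi|->] := ltngtP i n.
  - by rewrite mulr0n add0r hg.
  - rewrite mulr0n add0r rmorph0 nth_default //.
    by rewrite -(prednK sP).
  by rewrite mulr1n addr0 rmorph1 -(monicP Pm) lead_coefE.
have [rs hrs] := vring_split Qm; exists (map rho rs).
rewrite hQ hrs rmorph_prod big_map; apply: eq_bigr => r _.
by rewrite rmorphB /= map_polyX map_polyC.
Qed.

(** Elements of C that are algebraic over K, such as pi2, lie in K. *)
Lemma closed_subfield_root (P : {poly K}) z : P \is monic ->
  root (map_poly j P) z -> exists x, z = j x.
Proof.
move=> Pm; have [rs] := closed_field_poly_normal P.
rewrite (monicP Pm) scale1r => ->; rewrite rmorph_prod.
have -> : \prod_(r <- rs) map_poly j ('X - r%:P) =
    \prod_(r <- map j rs) ('X - r%:P).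
  rewrite big_map; apply: eq_bigr => r _.
  by rewrite rmorphB /= map_polyX map_polyC.
by rewrite root_prod_XsubC => /mapP[r hr ->]; exists r.
Qed.

End ClosedSubfield.

(** * Frobenius and Moore determinants *)

Section Frobenius.
Variables (p q : nat) (B : idomainType).
Hypotheses (charB : p \in [pchar B]) (pq : p.-nat q).
Implicit Types x y : B.

Lemma frobD x y : (x + y) ^+ q = x ^+ q + y ^+ q.
Proof.
apply: exprDn_pchar; apply: sub_in_pnat pq => l _.
by rewrite inE => /eqP ->.
Qed.

Lemma frob_gt0 : (0 < q)%N. Proof. by case/andP: pq. Qed.

Lemma frobN x : (- x) ^+ q = - x ^+ q.
Proof.
apply/eqP; rewrite -addr_eq0 -frobD addNr expr0n.
by rewrite (gtn_eqF frob_gt0).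
Qed.

Lemma frobB x y : (x - y) ^+ q = x ^+ q - y ^+ q.
Proof. by rewrite frobD frobN. Qed.

Lemma frob_inj : injective (fun x => x ^+ q).
Proof.
move=> x y /eqP; rewrite -subr_eq0 -frobB expf_eq0 frob_gt0 /= subr_eq0.
by move/eqP.
Qed.

Lemma frob_natr0 : (1 < q)%N -> q%:R = 0 :> B.
Proof.
move=> q1; have /dvdnP[m ->] : (p %| q)%N.
  have [[|e] h] := p_natP pq; first by rewrite h in q1.
  by rewrite h expnS dvdn_mulr.
by rewrite natrM (pcharf0 charB) mulr0.
Qed.

End Frobenius.

(** Given X2 and X1 = [pi]_u(X2), a nonzero root of [pi]_u, let
    W(Y) = X1 Y^q - X1^q Y be the Moore determinant. The identity
    X1^q [pi]_u(Y) = W(Y)^q - pi W(Y) = - [pi]_LT(W(Y)) turns torsion conditions on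
    Y into torsion conditions on W(Y). Moreover mu2(X2, Y2) = W(Y2) + Z, with
    Z = X2 Y1^q - X2^q Y1. So a point with mu2 = pi2 arises from any solution Y1 of
    W(Y1) = [pi]_LT(pi2) and any solution Y2 of W(Y2) = pi2 - Z: the torsion
    conditions hold automatically. *)
Section Moore.
Variables (p q : nat) (K : fieldType).
Hypotheses (charK : p \in [pchar K]) (pq : p.-nat q).
Variables (pi u X1 X2 Y1 : K).
Hypothesis X1_neq0 : X1 != 0.
Hypothesis X1E : pi_u q pi u X2 = X1.
Hypothesis X1_root : pi_u q pi u X1 = 0.

Definition moore (Y : K) := X1 * Y ^+ q - X1 ^+ q * Y.

Lemma moore_pi_u Y :
  X1 ^+ q * pi_u q pi u Y = moore Y ^+ q - pi * moore Y.
Proof.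
rewrite /moore (frobB charK pq) !exprMn.
have -> : (X1 ^+ q) ^+ q = - u * X1 ^+ q - pi * X1.
  apply/eqP; rewrite -subr_eq0 -X1_root /pi_u -exprM mulnn; apply/eqP; ring.
by rewrite /pi_u -mulnn exprM; ring.
Qed.

Hypothesis Y1_root : pi_u q pi u Y1 = 0.

Definition moore_corr := X2 * Y1 ^+ q - X2 ^+ q * Y1.

Lemma moore_corrE : pi * moore_corr - moore_corr ^+ q = X1 * Y1 ^+ q.
Proof.
rewrite /moore_corr (frobB charK pq) !exprMn.
have -> : (Y1 ^+ q) ^+ q = - u * Y1 ^+ q - pi * Y1.
  apply/eqP; rewrite -subr_eq0 -Y1_root /pi_u -exprM mulnn; apply/eqP; ring.
by rewrite -X1E /pi_u -mulnn exprM; ring.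
Qed.

(** Hence [pi]_LT(pi2 - Z) = W(Y1) - X1 Y1^q = - X1^q Y1; besides implying
    [pi]_u(Y2) = Y1, this equation determines the size of pi2 - Z, which is smaller
    than that of either term. *)
Lemma moore_level2 pi2 : pi_LT q pi pi2 = moore Y1 ->
  (pi2 - moore_corr) ^+ q - pi * (pi2 - moore_corr) = X1 ^+ q * Y1.
Proof.
rewrite /pi_LT => h1; move: moore_corr moore_corrE => Z h2.
rewrite (frobB charK pq).
have -> : pi2 ^+ q - Z ^+ q - pi * (pi2 - Z) =
  - (pi * pi2 - pi2 ^+ q) + (pi * Z - Z ^+ q) by ring.
by rewrite h1 h2 /moore; ring.
Qed.

Lemma moore_torsion pi2 Y2 : pi_LT q pi pi2 = moore Y1 ->
  moore Y2 = pi2 - moore_corr -> pi_u q pi u Y2 = Y1.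
Proof.
move=> h1 h2; apply: (mulfI (expf_neq0 q X1_neq0)).
by rewrite moore_pi_u h2 moore_level2.
Qed.

End Moore.

(** * Scaling by a root of pi2 *)

Section Exponents.
Variable q : nat.
Hypothesis q1 : (1 < q)%N.

(** In units of v(beta), where beta^(q^3+q^2) = pi2, the valuations of pi, u, X1,
    X2, Y1 and Y2 are q^5-q^3, q^4-q^3, q^4, q^2, q^2 and 1. The dominated terms of
    the equations exceed the dominant ones by multiples of (q-1)(q^2-1), so they
    are divisible by beta. *)
Definition gap : nat := ((q - 1) * (q ^ 2 - 1))%N.
Definition expo_pi : nat := (q ^ 5 - q ^ 3)%N.
Definition expo_u : nat := (q ^ 4 - q ^ 3)%N.

(** Through this relation every comparison of exponents becomes an identity without
    subtraction. *)
Lemma gapE : (gap + q ^ 2 + q = q ^ 3 + 1)%N.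
Proof.
rewrite /gap; case: q q1 => [|[|s]] // _.
rewrite subn1 /= (_ : s.+2 ^ 2 - 1 = s * s + 4 * s + 3)%N; nia.
Qed.

Lemma gap_gt0 : (0 < gap)%N.
Proof. by rewrite /gap muln_gt0 !subn_gt0 q1 -{1}(exp1n 2) ltn_exp2r. Qed.

Lemma expo_piE : (expo_pi + q ^ 3 = q ^ 5)%N.
Proof. by rewrite subnK // leq_exp2l. Qed.

Lemma expo_uE : (expo_u + q ^ 3 = q ^ 4)%N.
Proof. by rewrite subnK // leq_exp2l. Qed.

End Exponents.

(** On the circles of radii |B|, |B|^(q^2) and |B|^(q^4), of Y2, of X2 and Y1, and of
    X1, one, two and two of the three terms of [pi]_u dominate. *)
Section PiUScale.
Variables (K : fieldType) (q : nat) (B w z : K).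
Hypothesis q1 : (1 < q)%N.
Local Notation piw := (w * B ^+ expo_pi q).
Local Notation uz := (B ^+ expo_u q * z).

Lemma expr_sub0 m n : m = n -> B ^+ m - B ^+ n = 0.
Proof. by move=> ->; rewrite subrr. Qed.

Lemma pi_u_scale1 t : pi_u q piw uz (B * t) = B ^+ (q ^ 2) *
  (t ^+ (q ^ 2) + B ^+ (q * gap q) * (z * t ^+ q)
   + B ^+ (gap q * (q ^ 2 + q + 1)) * (w * t)).
Proof.
have g := gapE q1; have gpi := expo_piE q1; have gu := expo_uE q1.
have e2 : B ^+ (expo_u q + q) - B ^+ (q ^ 2 + q * gap q) = 0.
  by apply: expr_sub0; nia.
have e3 : B ^+ (expo_pi q + 1) - B ^+ (q ^ 2 + gap q * (q ^ 2 + q + 1)) = 0.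
  by apply: expr_sub0; nia.
rewrite /pi_u !exprMn; apply: subr0_eq; move: e2 e3.
rewrite !exprD expr1.
move: B (B ^+ expo_u q) (B ^+ q) (B ^+ expo_pi q)
  (B ^+ (q ^ 2)) (B ^+ (q * gap q)) (B ^+ (gap q * (q ^ 2 + q + 1)))
  => B1 Bu Bq Bpi B2 Bg Bh.
move: (t ^+ (q ^ 2)) (t ^+ q) => t2 t1 e2 e3.
rewrite [LHS](_ : _ = z * t1 * (Bu * Bq - B2 * Bg) + w * t * (Bpi * B1 - B2 * Bh)).
  by rewrite e2 e3 !mulr0 addr0.
by ring.
Qed.

Lemma pi_u_scale2 t : pi_u q piw uz (B ^+ (q ^ 2) * t) = B ^+ (q ^ 4) *
  (t ^+ (q ^ 2) + z * t ^+ q + B ^+ (q ^ 2 * gap q) * (w * t)).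
Proof.
have g := gapE q1; have gpi := expo_piE q1; have gu := expo_uE q1.
have e1 : (q ^ 2 * q ^ 2 = q ^ 4)%N by nia.
have e2 : B ^+ (expo_u q + q ^ 2 * q) - B ^+ (q ^ 4) = 0 by apply: expr_sub0; nia.
have e3 : B ^+ (expo_pi q + q ^ 2) - B ^+ (q ^ 4 + q ^ 2 * gap q) = 0.
  by apply: expr_sub0; nia.
rewrite /pi_u !exprMn -!exprM e1; apply: subr0_eq; move: e2 e3; rewrite !exprD.
move: (B ^+ expo_u q) (B ^+ (q ^ 2 * q)) (B ^+ (q ^ 4)) (B ^+ expo_pi q)
  (B ^+ (q ^ 2)) (B ^+ (q ^ 2 * gap q)) => Bu B2q B4 Bpi B2 Bg.
move: (t ^+ (q ^ 2)) (t ^+ q) => t2 t1 e2 e3.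
rewrite [LHS](_ : _ = z * t1 * (Bu * B2q - B4) + w * t * (Bpi * B2 - B4 * Bg)).
  by rewrite e2 e3 !mulr0 addr0.
by ring.
Qed.

Lemma pi_u_scale4 t : pi_u q piw uz (B ^+ (q ^ 4) * t) = B ^+ (expo_pi q + q ^ 4) *
  (z * t ^+ q + w * t + B ^+ (q ^ 3 * gap q) * t ^+ (q ^ 2)).
Proof.
have g := gapE q1; have gpi := expo_piE q1; have gu := expo_uE q1.
have e1 : B ^+ (q ^ 4 * q ^ 2) - B ^+ (expo_pi q + q ^ 4 + q ^ 3 * gap q) = 0.
  by apply: expr_sub0; nia.
have e2 : B ^+ (expo_u q + q ^ 4 * q) - B ^+ (expo_pi q + q ^ 4) = 0.
  by apply: expr_sub0; nia.
rewrite /pi_u !exprMn -!exprM; apply: subr0_eq; move: e1 e2; rewrite !exprD.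
move: (B ^+ expo_u q) (B ^+ (q ^ 4 * q)) (B ^+ (q ^ 4)) (B ^+ expo_pi q)
  (B ^+ (q ^ 4 * q ^ 2)) (B ^+ (q ^ 3 * gap q)) => Bu B4q B4 Bpi B6 Bg.
move: (t ^+ (q ^ 2)) (t ^+ q) => t2 t1 e1 e2.
rewrite [LHS](_ : _ = t2 * (B6 - Bpi * B4 * Bg) + z * t1 * (Bu * B4q - Bpi * B4)).
  by rewrite e1 e2 !mulr0 addr0.
by ring.
Qed.

End PiUScale.

Section Radii.
Variables (R : realType) (q : nat).
Hypothesis q1 : (1 < q)%N.
Local Notation Q := (q%:R : R).

Definition rad_beta : R := (Q ^+ 3 * (Q ^+ 2 - 1))^-1.

Lemma Q_gt1 : 1 < Q. Proof. by rewrite ltr1n. Qed.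

Lemma rad_beta_gt0 : 0 < rad_beta.
Proof.
have := Q_gt1 => h; rewrite invr_gt0 mulr_gt0 ?exprn_gt0 //; nra.
Qed.

Lemma rad_beta_u : rad_beta *+ expo_u q = rad_u R q.
Proof.
have := Q_gt1 => h; rewrite -mulr_natr natrB ?leq_exp2l // !natrX /rad_beta /rad_u.
by field; apply/and3P; split; apply/eqP; nra.
Qed.
Lemma rad_beta_X1 : rad_beta *+ (q ^ 4) = rad_X1 R q.
Proof.
have := Q_gt1 => h; rewrite -mulr_natr natrX /rad_beta /rad_X1.
by field; apply/andP; split; apply/eqP; nra.
Qed.
Lemma rad_beta_X2 : rad_beta *+ (q ^ 2) = rad_X2 R q.
Proof.
have := Q_gt1 => h; rewrite -mulr_natr natrX /rad_beta /rad_X2.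
by field; apply/andP; split; apply/eqP; nra.
Qed.
Lemma rad_beta_Y2 : rad_beta *+ 1 = rad_Y2 R q.
Proof. by []. Qed.
Lemma rad_beta_pi : rad_beta *+ expo_pi q = 1.
Proof.
have := Q_gt1 => h; rewrite -mulr_natr natrB ?leq_exp2l // !natrX /rad_beta.
by field; apply/andP; split; apply/eqP; nra.
Qed.
End Radii.

Section Scaling.
Variables (R : realType) (K : closedFieldType) (C : fieldType).
Variables (v : valuation R C) (j : {rmorphism K -> C}).
Local Notation W := (vring (pullback v j)).
Local Notation vK := (pullback v j).

Variables (q : nat) (pi : K).
Hypothesis q1 : (1 < q)%N.
Hypothesis vpi : vK pi = 1%:E.
Local Notation Q := (q%:R : R).
Local Notation rb := (rad_beta R q).

Lemma LT_root_closed (a c z : C) (a' c' : K) : a = j a' -> c = j c' ->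
  z ^+ q + (a * z + c) = 0 -> exists x, z = j x.
Proof.
move=> -> -> h; apply: (closed_subfield_root (trinomial_monic a' c' q1)).
rewrite rmorphD /= map_polyXn rmorphD /= map_polyZ map_polyX map_polyC /=.
by rewrite /root horner_trinomial h.
Qed.

Lemma rho_unit (a : W) : rho v j a != 0 -> vK (vring_val a) = 0%:E.
Proof.
rewrite /= residue_eq0 unfold_in /= -leNgt => h.
by apply/eqP; rewrite eq_le h; exact: (vringP a).
Qed.

Lemma rho_eq0 (a : W) (r : R) : 0 < r -> (r%:E <= vK (vring_val a))%E -> rho v j a = 0.
Proof.
move=> r0 h; apply/eqP; rewrite /= residue_eq0 unfold_in /=.
by apply: lt_le_trans h; rewrite lte_fin.
Qed.

Lemma LT_generator_descent pi2 : LT_generator q (j pi) pi2 ->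
  exists2 p2 : K, j p2 = pi2 & LT_generator q pi p2.
Proof.
move=> [h0 h1].
have [p1 hp1] : exists x, pi_LT q (j pi) pi2 = j x.
  apply: (@LT_root_closed (- j pi) 0 _ (- pi) 0); rewrite ?rmorphN ?rmorph0 //.
  by rewrite addr0 -[RHS]oppr0 -h0 {3}/pi_LT; ring.
have [p2 hp2] : exists x, pi2 = j x.
  apply: (@LT_root_closed (- j pi) (j p1) _ (- pi) p1); rewrite ?rmorphN //.
  by rewrite -hp1 /pi_LT; ring.
have hj x : pi_LT q (j pi) (j x) = j (pi_LT q pi x).
  by rewrite /pi_LT rmorphB rmorphM rmorphXn.
exists p2 => //; split; first by apply: (fmorph_inj j); rewrite -!hj -hp2 rmorph0.
by move=> h; apply: h1; rewrite hp2 hj h rmorph0.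
Qed.

(** pi1 = [pi]_LT(pi2) satisfies pi1^(q-1) = pi, so v(pi1) = 1/(q-1). In
    pi1 = pi pi2 - pi2^q the last term must dominate, so q v(pi2) = v(pi1). *)
Lemma LT_generator_val p2 : LT_generator q pi p2 ->
  vK p2 = (rb *+ (q ^ 3 + q ^ 2))%:E.
Proof.
move=> [h0 h1]; set p1 := pi_LT q pi p2 in h0 h1.
have q0 : (0 < q)%N by rewrite ltnW.
have [s1 hs1] := val_fin vK (introN eqP h1).
have p20 : p2 != 0.
  apply/eqP => h; apply: h1; rewrite /p1 h /pi_LT mulr0 expr0n gtn_eqF //.
  by rewrite subr0.
have [s hs] := val_fin vK p20.
have e1 : s1 *+ q = 1 + s1.
  have : vK (p1 ^+ q) = vK (pi * p1).
    by congr (vK _); apply/esym/eqP; rewrite -subr_eq0; apply/eqP.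
  by rewrite (val_exp _ hs1) valM vpi hs1 => -[].
have ve : vK (pi * p2) = (1 + s)%:E by rewrite valM vpi hs.
have vq : vK (p2 ^+ q) = (s *+ q)%:E by rewrite (val_exp _ hs).
have A (m : R) : m <= 1 + s -> m <= s *+ q -> m <= s1.
  move=> a b; rewrite -lee_fin -hs1 /p1; apply: val_leB.
    by rewrite ve lee_fin.
  by rewrite vq lee_fin.
have B (m : R) : m <= 1 + s -> m <= s1 -> m <= s *+ q.
  move=> a b; rewrite -lee_fin -vq.
  have -> : p2 ^+ q = pi * p2 - p1 by rewrite /p1 /pi_LT; ring.
  by apply: val_leB; rewrite ?ve ?hs1 lee_fin.
have hQ := Q_gt1 R q1.
move: e1 A B; rewrite -(mulr_natr s1 q) -(mulr_natr s q) => e1 A B.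
have e2 : s * Q = s1.
  apply/eqP; rewrite eq_le; apply/andP; split; rewrite leNgt; apply/negP => lt.
    have [h|h] := leP (1 + s) (s * Q).
      by have := A _ (lexx _) h; nra.
    by have := A _ (ltW h) (lexx _); nra.
  have [h|h] := leP (1 + s) s1.
    by have := B _ (lexx _) h; nra.
  by have := B _ (ltW h) (lexx _); nra.
rewrite hs; congr (_%:E).
rewrite -mulr_natr natrD !natrX /rad_beta.
have -> : s = (Q * (Q - 1))^-1.
  apply: (mulIf (_ : Q * (Q - 1) != 0)); first by apply/eqP; nra.
  rewrite mulVf; last by apply/eqP; nra.
  by move: e1; rewrite -e2 => e1; nra.
by field; apply/and3P; split; apply/eqP; nra.
Qed.

(** beta is the unit of scale; omega and kappa, which reduce to 1, say by which
    factors pi and [pi]_LT(pi2) deviate from powers of beta. *)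
Record scaling (p2 : K) (beta omega kappa : W) : Prop := {
  scal_beta : vring_val beta ^+ (q ^ 3 + q ^ 2) = p2;
  scal_val : vK (vring_val beta) = rb%:E;
  scal_pi : pi = vring_val omega * vring_val beta ^+ expo_pi q;
  scal_pi1 : pi_LT q pi p2 = - (vring_val kappa * vring_val beta ^+ (q ^ 4 + q ^ 3));
  scal_omega : rho v j omega = 1;
  scal_kappa : rho v j kappa = 1 }.

End Scaling.

Section ScalingExists.
Variables (R : realType) (K : closedFieldType) (C : fieldType).
Variables (v : valuation R C) (j : {rmorphism K -> C}).
Local Notation W := (vring (pullback v j)).
Local Notation vK := (pullback v j).

Variables (p q : nat) (pi p2 : K).
Local Notation rb := (rad_beta R q).
Hypotheses (charK : p \in [pchar K]) (pq : p.-nat q) (q1 : (1 < q)%N).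
Hypothesis vpi : vK pi = 1%:E.
Hypothesis p2_gen : LT_generator q pi p2.

Lemma vring_lift (x : K) (r : R) : vK x = r%:E -> 0 <= r ->
  exists a : W, vring_val a = x.
Proof.
move=> h r0; have hi : x \in vint vK by rewrite unfold_in h lee_fin.
by exists (VRing hi).
Qed.

(** kappa = 1 - pi pi2 / pi2^q, whose second term is small. Then pi1^q = pi pi1
    reads omega kappa = kappa^q, so omega reduces to 1 as well. *)
Lemma scaling_exists : exists beta omega kappa : W,
  scaling q pi p2 beta omega kappa.
Proof.
set n := (q ^ 3 + q ^ 2)%N.
have n0 : (0 < n)%N by rewrite addn_gt0 expn_gt0 ltnW.
have v2 := LT_generator_val q1 vpi p2_gen.
have [b hb] : exists b : K, b ^+ n = p2.
  have /closed_rootP[b] : size ('X^n - p2%:P) != 1%N.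
    by rewrite size_XnsubC // eqSS -lt0n.
  by rewrite /root hornerD hornerN hornerXn hornerC subr_eq0 => /eqP; exists b.
have b0 : b != 0.
  by apply/eqP => e; move: (val_neq0 v2); rewrite -hb e expr0n gtn_eqF ?eqxx.
have vb : vK b = rb%:E.
  have [r hr] := val_fin vK b0.
  move: v2; rewrite -hb (val_exp _ hr) => -[/eqP].
  by rewrite eqr_pMn2r // hr => /eqP ->.
have rb0 := rad_beta_gt0 R q1.
have [beta hbeta] := vring_lift vb (ltW rb0).
have bn0 m : b ^+ m != 0 by rewrite expf_neq0.
have vbn m : vK (b ^+ m) = (rb *+ m)%:E by rewrite (val_exp _ vb).
have vV m : vK (b ^+ m)^-1 = (- (rb *+ m))%:E by rewrite (valV (vbn m)).
have hpi : vK pi = (rb *+ expo_pi q)%:E by rewrite vpi rad_beta_pi.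
have [omega homega] : exists a : W, vring_val a = pi / b ^+ expo_pi q.
  by apply: (@vring_lift _ 0) => //; rewrite valM hpi vV -EFinD subrr.
pose d := gap q.
have ed : (expo_pi q + n = q ^ 4 + q ^ 3 + q ^ 2 * d)%N.
  have := gapE q1; have := expo_piE q1; rewrite -/d /n.
  by move: (expo_pi q) => z h1 h2; nia.
have [eps heps] : exists a : W, vring_val a = pi * p2 / b ^+ (q ^ 4 + q ^ 3).
  apply: (@vring_lift _ (rb *+ (q ^ 2 * d))); last by rewrite mulrn_wge0 // ltW.
  rewrite !valM hpi v2 vV -!EFinD -mulrnDr ed mulrnDr addrC addrA addNr add0r //.
have veps : vK (vring_val eps) = (rb *+ (q ^ 2 * d))%:E.
  by rewrite heps !valM hpi v2 vV -!EFinD -mulrnDr ed mulrnDr addrC addrA addNr add0r.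
have reps : rho v j eps = 0.
  apply: (@rho_eq0 _ _ _ _ _ _ (rb *+ (q ^ 2 * d))); last by rewrite veps.
  by rewrite pmulrn_lgt0 // muln_gt0 expn_gt0 (ltnW q1) gap_gt0.
pose kappa : W := 1 - eps.
have p2q : p2 ^+ q = b ^+ (q ^ 4 + q ^ 3).
  by rewrite -hb -exprM; congr (_ ^+ _); rewrite /n; nia.
have hp1 : pi_LT q pi p2 = - (vring_val kappa * b ^+ (q ^ 4 + q ^ 3)).
  have -> : vring_val kappa = 1 - vring_val eps by rewrite /kappa rmorphB rmorph1.
  by rewrite heps /pi_LT p2q mulrBl divfK // mul1r; ring.
have rkappa : rho v j kappa = 1 by rewrite /kappa rmorphB rmorph1 reps subr0.
have hpiE : pi = vring_val omega * b ^+ expo_pi q by rewrite homega divfK.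
exists beta, omega, kappa; split; rewrite ?hbeta //.
have e : omega * kappa = kappa ^+ q.
  apply: vring_val_inj; rewrite rmorphM rmorphXn.
  apply: (mulIf (bn0 (q ^ 5 + q ^ 4)%N)).
  have [h0 _] := p2_gen; move: h0; rewrite {1}/pi_LT hp1.
  rewrite (frobN charK pq) exprMn -exprM {1}hpiE => h0.
  have e1 : (expo_pi q + (q ^ 4 + q ^ 3) = q ^ 5 + q ^ 4)%N.
    by have := expo_piE q1; nia.
  have e2 : ((q ^ 4 + q ^ 3) * q = q ^ 5 + q ^ 4)%N by nia.
  rewrite e2 in h0; rewrite -{1}e1 exprD; apply/eqP; rewrite -subr_eq0 -oppr_eq0.
  by rewrite -h0; apply/eqP; ring.
by have := congr1 (rho v j) e; rewrite rmorphM rmorphXn rkappa expr1n mulr1.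
Qed.

End ScalingExists.

(** * Lifting points of the curve *)

Section PointLifting.
Variables (R : realType) (K : closedFieldType) (C : fieldType).
Variables (v : valuation R C) (j : {rmorphism K -> C}).
Local Notation W := (vring (pullback v j)).
Local Notation vK := (pullback v j).
Local Notation k := (residue_field v).
Local Notation rho := (rho v j).
Hypothesis dense : forall (x : C) (M : R), exists a, (M%:E <= v (x - j a)%R)%E.

Variables (p q : nat) (pi p2 : K).
Local Notation rb := (rad_beta R q).
Hypotheses (charK : p \in [pchar K]) (pq : p.-nat q) (q1 : (1 < q)%N).
Hypothesis p2_gen : LT_generator q pi p2.
Variables (beta omega kappa : W).
Hypothesis scal : scaling q pi p2 beta omega kappa.

Lemma rho_inv (a : W) : rho a != 0 -> exists a' : W, a * a' = 1.
Proof.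
move=> /rho_unit h; have h0 : (0 : R) <= - 0 by rewrite oppr0.
have [a' ha'] := vring_lift (valV h) h0.
exists a'; apply: vring_val_inj; rewrite !vring_valE ha' divff //.
exact: val_neq0 h.
Qed.

Lemma rho_beta_exp n : (0 < n)%N -> rho (beta ^+ n) = 0.
Proof.
move=> n0; apply: (@rho_eq0 _ _ _ _ _ _ (rb *+ n)).
  by rewrite pmulrn_lgt0 // rad_beta_gt0.
by rewrite vring_valE (val_exp _ (scal_val scal)).
Qed.

Lemma trinomial_root (a c : W) : exists x : W, x ^+ q + (a * x + c) = 0.
Proof.
have [rs hrs] := vring_split (trinomial_monic a c q1).
have := size_trinomial a c q1.
case: rs hrs => [|x rs] hrs; first by rewrite hrs big_nil size_poly1; lia.
move=> _; exists x; rewrite -horner_trinomial.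
by rewrite hrs horner_prod big_cons hornerXsubC subrr mul0r.
Qed.

Variables x0 y0 : k.
Hypothesis on_curve : - (x0 ^+ q * y0 ^+ (q ^ 2)) + x0 * y0 ^+ (q ^ 3) = 1.

Let charR : p \in [pchar k].
Proof. by apply: residue_field_pchar; rewrite (fmorph_pchar j). Qed.

Lemma curve_point_neq0 : (x0 != 0) && (y0 != 0).
Proof.
have q0 : (0 < q)%N by rewrite ltnW.
apply/andP; split; apply/eqP => e; move: on_curve; rewrite e !expr0n.
  by rewrite gtn_eqF // !mul0r oppr0 addr0 => /eqP; rewrite eq_sym oner_eq0.
rewrite !gtn_eqF ?expn_gt0 ?q0 // !mulr0 oppr0 addr0 => /eqP.
by rewrite eq_sym oner_eq0.
Qed.

Lemma curve_point_frob :
  - (x0 ^+ (q ^ 2) * y0 ^+ (q ^ 3)) + x0 ^+ q * y0 ^+ (q ^ 4) = 1.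
Proof.
have := congr1 (fun z => z ^+ q) on_curve; rewrite expr1n => <-.
by rewrite (frobD charR pq) (frobN charR pq) !exprMn -!exprM mulnn -!expnSr.
Qed.

(** The choices behind a point above (x0, y0), rescaled to be integral: b lifts y0,
    x1 and ut are X1 and u, xi is X2, eta is Y1, zeta is Y2, and gam is pi2 - Z. The
    value x1 = - 1/b^(q^3) is forced by the equation of the curve, u by
    [pi]_u(X1) = 0, and the other unknowns are roots of monic integral equations. *)
Section Construction.
Variables (b b' x1 x1' ut xi eta gam zeta : W).
Hypotheses (rb : rho b = y0) (bK : b * b' = 1).
Hypothesis x1E : x1 = - b' ^+ (q ^ 3).
Hypothesis x1'E : x1' = - b ^+ (q ^ 3).
Hypothesis utE : ut = - (omega * x1 * x1' ^+ q
  + beta ^+ (q ^ 3 * gap q) * x1 ^+ (q ^ 2) * x1' ^+ q).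

Lemma x1K : x1 * x1' = 1.
Proof. by rewrite x1E x1'E mulrNN -exprMn (mulrC b') bK expr1n. Qed.

Lemma rho_x1 : rho x1 = - (y0^-1) ^+ (q ^ 3).
Proof.
rewrite x1E rmorphN rmorphXn; congr (- _ ^+ _).
have [_ y00] := andP curve_point_neq0.
by apply: (mulfI y00); rewrite divff // -rb -rmorphM bK rmorph1.
Qed.

Lemma rho_ut : rho ut = - (y0 ^+ (q ^ 4) * (y0^-1) ^+ (q ^ 3)).
Proof.
rewrite utE rmorphN rmorphD !rmorphM (rho_beta_exp (n := q ^ 3 * gap q)); last first.
  by rewrite muln_gt0 expn_gt0 (ltnW q1) gap_gt0.
rewrite !mul0r addr0 (scal_omega scal) mul1r rho_x1 rmorphXn x1'E rmorphN rmorphXn.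
by rewrite (frobN charR pq) -exprM -expnSr rb; congr (- _); ring.
Qed.

(** Up to the factor y0^(q^3), the reduction of the rescaled equation
    [pi]_u(X2) = X1 at x0 is the q-th power of the equation of the curve. *)
Lemma xi_reduction :
  x0 ^+ (q ^ 2) + (rho ut * x0 ^+ q - rho x1) = 0.
Proof.
have [_ y00] := andP curve_point_neq0.
apply: (mulfI (expf_neq0 (q ^ 3) y00)); rewrite mulr0.
have e : y0 ^+ (q ^ 3) * (y0^-1) ^+ (q ^ 3) = 1 by rewrite -exprMn divff ?expr1n.
rewrite rho_ut rho_x1 -[RHS](subrr 1) -{2}curve_point_frob -{1}e.
move: e; move: (y0 ^+ (q ^ 3)) (y0 ^+ (q ^ 4)) ((y0^-1) ^+ _) => s t z e.
move: (x0 ^+ q) (x0 ^+ (q ^ 2)) => f g.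
have -> : s * (g + (- (t * z) * f - - z)) = s * g - (s * z) * t * f + s * z by ring.
by rewrite e; ring.
Qed.


Hypothesis xiE : xi ^+ (q ^ 2) + (ut * xi ^+ q + omega * beta ^+ (q ^ 2 * gap q) * xi - x1) = 0.
Hypothesis xi_x0 : rho xi = x0.
Hypothesis etaE :
  eta ^+ q + (- (beta ^+ (q ^ 2 * gap q) * x1 ^+ q * x1') * eta + kappa * x1') = 0.

Local Notation B := (vring_val beta).
Definition lift_X1 : K := B ^+ (q ^ 4) * vring_val x1.
Definition lift_u : K := B ^+ expo_u q * vring_val ut.
Definition lift_X2 : K := B ^+ (q ^ 2) * vring_val xi.
Definition lift_Y1 : K := B ^+ (q ^ 2) * vring_val eta.

Let g := gapE q1.
Let gpi := expo_piE q1.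
Let gu := expo_uE q1.

Lemma lift_X1_neq0 : lift_X1 != 0.
Proof.
rewrite mulf_neq0 ?expf_neq0 ?(val_neq0 (scal_val scal)) //.
apply/eqP => h; have /(congr1 (@vring_val _ _ _)) := x1K.
by rewrite !vring_valE h mul0r => /eqP; rewrite eq_sym oner_eq0.
Qed.

Lemma lift_X2E : pi_u q pi lift_u lift_X2 = lift_X1.
Proof.
rewrite /lift_u /lift_X1 /lift_X2 (scal_pi scal) pi_u_scale2 //; congr (_ * _).
have := congr1 (@vring_val _ _ _) xiE; rewrite !vring_valE => e.
by apply: subr0_eq; rewrite -e; ring.
Qed.

Lemma lift_X1_root : pi_u q pi lift_u lift_X1 = 0.
Proof.
have : ut * x1 ^+ q + omega * x1 + beta ^+ (q ^ 3 * gap q) * x1 ^+ (q ^ 2) = 0.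
  have e : x1' ^+ q * x1 ^+ q - 1 = 0 by rewrite -exprMn mulrC x1K expr1n subrr.
  rewrite utE; move: e; move: (x1' ^+ q) (x1 ^+ q) (x1 ^+ (q ^ 2)) => s t z e.
  rewrite [LHS](_ : _ = - (omega * x1 + beta ^+ (q ^ 3 * gap q) * z) * (s * t - 1)).
    by rewrite e mulr0.
  by ring.
move/(congr1 (@vring_val _ _ _)); rewrite !vring_valE => e.
by rewrite /lift_u /lift_X1 (scal_pi scal) pi_u_scale4 // e mulr0.
Qed.

Lemma lift_moore1 : pi_LT q pi p2 = moore q lift_X1 lift_Y1.
Proof.
have : x1 * eta ^+ q - beta ^+ (q ^ 2 * gap q) * x1 ^+ q * eta + kappa = 0.
  have e : x1 * x1' - 1 = 0 by rewrite x1K subrr.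
  move: etaE e; move: (eta ^+ q) (x1 ^+ q) => s t e1 e2.
  rewrite [LHS](_ : _ = x1 *
    (s + (- (beta ^+ (q ^ 2 * gap q) * t * x1') * eta + kappa * x1'))
    + (beta ^+ (q ^ 2 * gap q) * t * eta - kappa) * (x1 * x1' - 1)); last by ring.
  by rewrite e1 e2 !mulr0 addr0.
move/(congr1 (@vring_val _ _ _)); rewrite !vring_valE => e.
rewrite (scal_pi1 scal) /moore /lift_X1 /lift_Y1 !exprMn -!exprM.
have e1 : B ^+ (q ^ 4) * B ^+ (q ^ 2 * q) - B ^+ (q ^ 4 + q ^ 3) = 0.
  by rewrite -exprD -expnSr subrr.
have e2 : B ^+ (q ^ 4 * q) * B ^+ (q ^ 2)
    - B ^+ (q ^ 4 + q ^ 3) * B ^+ (q ^ 2 * gap q) = 0.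
  by rewrite -!exprD; apply/eqP; rewrite subr_eq0; apply/eqP; congr (_ ^+ _); nia.
apply/esym/subr0_eq; move: e e1 e2.
move: (B ^+ (q ^ 4 + q ^ 3)) (B ^+ (q ^ 4)) (B ^+ (q ^ 2 * q)) (B ^+ (q ^ 4 * q))
  (B ^+ (q ^ 2)) (B ^+ (q ^ 2 * gap q)) => T B4 B3 B5 B2 Bg.
move: (vring_val x1) (vring_val eta) (vring_val kappa) => x y z.
move: (x ^+ q) (y ^+ q) => t1 t2 e e1 e2.
rewrite [LHS](_ : _ = T * (x * t2 - Bg * t1 * y + z) + x * t2 * (B4 * B3 - T)
  - t1 * y * (B5 * B2 - T * Bg)); last by ring.
by rewrite e e1 e2 !mulr0 subr0 !addr0.
Qed.

Lemma lift_Y1_root : pi_u q pi lift_u lift_Y1 = 0.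
Proof.
apply: (mulfI (expf_neq0 q lift_X1_neq0)); rewrite mulr0.
rewrite (moore_pi_u charK pq lift_X1_root) -lift_moore1.
by have [h _] := p2_gen; rewrite -oppr0 -h [in RHS]/pi_LT opprB.
Qed.

(** The difference pi2 - Z is a root of a monic equation which, once rescaled, has
    integral coefficients: this bounds it although pi2 and Z are larger. *)
Lemma lift_gamma : exists2 g0 : W,
  g0 ^+ q + (- (omega * beta ^+ (q * gap q)) * g0 + - (x1 ^+ q * eta)) = 0 &
  vring_val g0 * B ^+ (q ^ 4 + q) = p2 - moore_corr q lift_X2 lift_Y1.
Proof.
have := moore_level2 charK pq lift_X2E lift_Y1_root lift_moore1.
set c := p2 - _ => hc; have B0 n : B ^+ n != 0.
  by rewrite expf_neq0 // (val_neq0 (scal_val scal)).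
have [z cE] : exists z, c = z * B ^+ (q ^ 4 + q).
  by exists (c / B ^+ (q ^ 4 + q)); rewrite divfK.
have [|g0 hg0] := @integral_in_vring _ _ _ _ _ _ z
  (trinomial_monic (- (omega * beta ^+ (q * gap q))) (- (x1 ^+ q * eta)) q1).
  rewrite rmorphD /= map_polyXn rmorphD /= map_polyZ map_polyX map_polyC /=.
  rewrite /root horner_trinomial.
  apply/eqP; apply: (mulfI (B0 (q ^ 5 + q ^ 2)%N)); rewrite mulr0.
  rewrite !vring_valE.
  move: hc; rewrite cE /lift_X1 /lift_Y1 !exprMn -!exprM (scal_pi scal).
  have e1 : B ^+ ((q ^ 4 + q) * q) - B ^+ (q ^ 5 + q ^ 2) = 0.
    by apply/eqP; rewrite subr_eq0; apply/eqP; congr (_ ^+ _); nia.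
  have e2 : B ^+ expo_pi q * B ^+ (q ^ 4 + q)
      - B ^+ (q ^ 5 + q ^ 2) * B ^+ (q * gap q) = 0.
    by rewrite -!exprD; apply/eqP; rewrite subr_eq0; apply/eqP; congr (_ ^+ _); nia.
  have e3 : B ^+ (q ^ 4 * q) * B ^+ (q ^ 2) - B ^+ (q ^ 5 + q ^ 2) = 0.
    by rewrite -!exprD; apply/eqP; rewrite subr_eq0; apply/eqP; congr (_ ^+ _); nia.
  move/eqP; rewrite -subr_eq0 => /eqP; move: e1 e2 e3; clear cE.
  move: (B ^+ expo_pi q) (B ^+ (q ^ 4 + q)) (B ^+ (q ^ 5 + q ^ 2)) (B ^+ (q * gap q))
    (B ^+ ((q ^ 4 + q) * q)) (B ^+ (q ^ 4 * q)) (B ^+ (q ^ 2)) => Bp B4 T Bg Tq B5 B2.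
  move: (vring_val x1) (vring_val eta) (vring_val omega) z => x y w z.
  move: (x ^+ q) (z ^+ q) => t1 t2 e1 e2 e3 e.
  rewrite [LHS](_ : _ = t2 * Tq - w * Bp * (z * B4) - t1 * B5 * (B2 * y)
    - t2 * (Tq - T) + w * z * (Bp * B4 - T * Bg) + t1 * y * (B5 * B2 - T)); last by ring.
  rewrite e1 e2 e3 !mulr0 subr0 !addr0 -e; ring.
rewrite /root horner_trinomial => /eqP hroot.
by exists g0; rewrite // hg0 -cE.
Qed.

Hypothesis gamE :
  gam ^+ q + (- (omega * beta ^+ (q * gap q)) * gam + - (x1 ^+ q * eta)) = 0.
Hypothesis gamK :
  vring_val gam * B ^+ (q ^ 4 + q) = p2 - moore_corr q lift_X2 lift_Y1.
Hypothesis zetaE :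
  zeta ^+ q + (- (beta ^+ (gap q * (q ^ 2 + 1)) * x1 ^+ q * x1') * zeta + - (gam * x1')) = 0.
Definition lift_Y2 : K := B * vring_val zeta.

Lemma lift_moore2 : moore q lift_X1 lift_Y2 = p2 - moore_corr q lift_X2 lift_Y1.
Proof.
have : x1 * zeta ^+ q - beta ^+ (gap q * (q ^ 2 + 1)) * x1 ^+ q * zeta - gam = 0.
  have e : x1 * x1' - 1 = 0 by rewrite x1K subrr.
  move: zetaE e; move: (zeta ^+ q) (x1 ^+ q) => s t e1 e2.
  rewrite [LHS](_ : _ = x1 *
    (s + (- (beta ^+ (gap q * (q ^ 2 + 1)) * t * x1') * zeta + - (gam * x1')))
    + (beta ^+ (gap q * (q ^ 2 + 1)) * t * zeta + gam) * (x1 * x1' - 1)); last by ring.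
  by rewrite e1 e2 !mulr0 addr0.
move/(congr1 (@vring_val _ _ _)); rewrite !vring_valE -gamK => e.
rewrite /moore /lift_X1 /lift_Y2 !exprMn -!exprM.
have e1 : B ^+ (q ^ 4) * B ^+ q - B ^+ (q ^ 4 + q) = 0 by rewrite -exprD subrr.
have e2 : B ^+ (q ^ 4 * q) * B - B ^+ (q ^ 4 + q) * B ^+ (gap q * (q ^ 2 + 1)) = 0.
  by rewrite -!exprD -exprSr; apply/eqP; rewrite subr_eq0; apply/eqP; congr (_ ^+ _); nia.
apply/subr0_eq; move: e e1 e2.
move: B (B ^+ (q ^ 4 + q)) (B ^+ (q ^ 4)) (B ^+ q) (B ^+ (q ^ 4 * q))
  (B ^+ (gap q * (q ^ 2 + 1))) => B0 T B4 B1 B5 Bg.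
move: (vring_val x1) (vring_val zeta) (vring_val gam) => x y z.
move: (x ^+ q) (y ^+ q) => t1 t2 e e1 e2.
rewrite [LHS](_ : _ = T * (x * t2 - Bg * t1 * y - z) + x * t2 * (B4 * B1 - T)
  - t1 * y * (B5 * B0 - T * Bg)); last by ring.
by rewrite e e1 e2 !mulr0 subr0 !addr0.
Qed.

Lemma lift_Y2E : pi_u q pi lift_u lift_Y2 = lift_Y1.
Proof.
exact: (moore_torsion charK pq lift_X1_neq0 lift_X2E lift_X1_root
  lift_Y1_root lift_moore1 lift_moore2).
Qed.

Lemma lift_mu2 : mu2 q pi lift_u lift_X2 lift_Y2 = p2.
Proof.
rewrite /mu2 lift_X2E lift_Y2E; have := lift_moore2; rewrite /moore /moore_corr => e.
have -> : p2 = (p2 - (lift_X2 * lift_Y1 ^+ q - lift_X2 ^+ q * lift_Y1))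
  + (lift_X2 * lift_Y1 ^+ q - lift_X2 ^+ q * lift_Y1) by rewrite subrK.
by rewrite -e; ring.
Qed.

Let frobI := @frob_inj p q k charR pq.

Lemma rho_eta : rho eta ^+ q = y0 ^+ (q ^ 3).
Proof.
have := congr1 rho etaE; rewrite rmorph0 !rmorphD !rmorphM rmorphN !rmorphM rmorphXn.
rewrite (scal_kappa scal) mul1r (rho_beta_exp (n := q ^ 2 * gap q)); last first.
  by rewrite muln_gt0 expn_gt0 (ltnW q1) gap_gt0.
rewrite !mul0r oppr0 mul0r add0r x1'E rmorphN rmorphXn rb => /eqP.
by rewrite subr_eq0 => /eqP.
Qed.

(** Modulo the maximal ideal the three equations are x1 zeta^q = gam,
    gam^q = x1^q eta and eta^q = - 1/x1 = y0^(q^3); so zeta^(q^3) = y0^(q^3). *)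
Lemma rho_zeta : rho zeta = y0.
Proof.
have hz : rho x1 * rho zeta ^+ q = rho gam.
  have := congr1 rho zetaE; rewrite rmorph0 !rmorphD !rmorphM !rmorphN !rmorphM rmorphXn.
  rewrite (rho_beta_exp (n := gap q * (q ^ 2 + 1))); last first.
    by rewrite muln_gt0 addn_gt0 orbT gap_gt0.
  rewrite !mul0r oppr0 mul0r add0r => /eqP; rewrite subr_eq0 => /eqP ->.
  by rewrite mulrCA -rmorphM x1K rmorph1 mulr1.
have hg : rho gam ^+ q = rho x1 ^+ q * rho eta.
  have := congr1 rho gamE; rewrite rmorph0 !rmorphD !rmorphM !rmorphN !rmorphM.
  rewrite (rho_beta_exp (n := q * gap q)); last first.
    by rewrite muln_gt0 (ltnW q1) gap_gt0.
  by rewrite !rmorphXn mulr0 oppr0 mul0r add0r => /eqP; rewrite subr_eq0 => /eqP.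
have x10 : rho x1 != 0.
  apply/eqP => h; have /(congr1 rho) := x1K.
  by rewrite rmorphM h mul0r rmorph1 => /eqP; rewrite eq_sym oner_eq0.
have he : (rho zeta ^+ q) ^+ q = rho eta.
  by apply: (mulfI (expf_neq0 q x10)); rewrite -exprMn hz.
do 3!apply: frobI; rewrite he rho_eta -!exprM; congr (_ ^+ _); nia.
Qed.

Lemma lift_val (a : W) n : rho a != 0 -> v (j (B ^+ n * vring_val a)) = (rad_beta R q *+ n)%:E.
Proof.
move=> /rho_unit h; rewrite -[LHS]/(vK _) valM h adde0.
exact: val_exp (scal_val scal).
Qed.

Lemma lift_point : exists t : Y31e1_point v q (j pi) (j p2),
  pt_X2 t = j lift_X2 /\ pt_Y2 t = j lift_Y2.
Proof.
have [x00 y00] := andP curve_point_neq0.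
have jpi_u u x : pi_u q (j pi) (j u) (j x) = j (pi_u q pi u x).
  by rewrite /pi_u !rmorphD !rmorphM !rmorphXn.
have u0 : rho ut != 0.
  by rewrite rho_ut oppr_eq0 mulf_neq0 ?expf_neq0 ?invr_eq0.
have e0 : rho eta != 0.
  apply/eqP => e; move: (esym rho_eta); rewrite e expr0n gtn_eqF ?(ltnW q1) //.
  by move/eqP; rewrite expf_eq0 (negbTE y00) andbF.
have x10 : rho x1 != 0 by rewrite rho_x1 oppr_eq0 expf_neq0 // invr_eq0.
have vu : v (j lift_u) = (rad_u R q)%:E by rewrite lift_val // rad_beta_u.
have vX1 : v (j lift_X1) = (rad_X1 R q)%:E by rewrite lift_val // rad_beta_X1.
have vX2 : v (j lift_X2) = (rad_X2 R q)%:E.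
  by rewrite lift_val ?xi_x0 // rad_beta_X2.
have vY1 : v (j lift_Y1) = (rad_Y1 R q)%:E by rewrite lift_val // rad_beta_X2.
have vY2 : v (j lift_Y2) = (rad_Y2 R q)%:E.
  by rewrite /lift_Y2 -[B]expr1 lift_val ?rho_zeta // rad_beta_Y2.
have u_gt0 : (0 < v (j lift_u))%E.
  by rewrite vu lte_fin invr_gt0 addr_gt0 // ltr0n ltnW.
have tX : pi2_u q (j pi) (j lift_u) (j lift_X2) = 0.
  by rewrite /pi2_u !jpi_u lift_X2E lift_X1_root rmorph0.
have tY : pi2_u q (j pi) (j lift_u) (j lift_Y2) = 0.
  by rewrite /pi2_u !jpi_u lift_Y2E lift_Y1_root rmorph0.
have tm : mu2 q (j pi) (j lift_u) (j lift_X2) (j lift_Y2) = j p2.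
  rewrite -lift_mu2 /mu2 !jpi_u.
  move: lift_X2 lift_Y2 (pi_u q pi lift_u lift_X2) (pi_u q pi lift_u lift_Y2).
  move=> x y x' y'.
  by rewrite rmorphD !rmorphB !rmorphM !rmorphXn.
pose P := LubinTatePoint u_gt0 tX tY tm.
have hX1 : pt_X1 P = j lift_X1 by rewrite /pt_X1 /= jpi_u lift_X2E.
have hY1 : pt_Y1 P = j lift_Y1 by rewrite /pt_Y1 /= jpi_u lift_Y2E.
have vX1' : v (pt_X1 P) = (rad_X1 R q)%:E by rewrite hX1.
have vY1' : v (pt_Y1 P) = (rad_Y1 R q)%:E by rewrite hY1.
by exists (@Y31e1Point R C v q (j pi) (j p2) P vu vX1' vX2 vY1' vY2).
Qed.

End Construction.

(** y0 is prescribed through X1, and x0 through the choice of X2 among the q^2 roots of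
    [pi]_u(X2) = X1; then any solutions Y1 and Y2 of the two Moore equations do. *)
Lemma curve_point_lift : exists (t : Y31e1_point v q (j pi) (j p2)) (xi zeta : W),
  [/\ pt_X2 t = j (vring_val beta ^+ (q ^ 2) * vring_val xi),
      pt_Y2 t = j (vring_val beta * vring_val zeta),
      rho xi = x0 & rho zeta = y0].
Proof.
have [x00 y00] := andP curve_point_neq0.
have [b hb] := rho_surj dense y0.
have [b' hb'] : exists b', b * b' = 1 by apply: rho_inv; rewrite hb.
pose x1 : W := - b' ^+ (q ^ 3); pose x1' : W := - b ^+ (q ^ 3).
pose ut := - (omega * x1 * x1' ^+ q
  + beta ^+ (q ^ 3 * gap q) * x1 ^+ (q ^ 2) * x1' ^+ q).
pose a := omega * beta ^+ (q ^ 2 * gap q).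
pose S : {poly W} := ut *: 'X^q + a *: 'X - x1%:P.
have sS : (size S < (q ^ 2).+1)%N.
  have q2 : (q < q ^ 2)%N by nia.
  apply: leq_ltn_trans (size_polyD _ _) _; rewrite gtn_max size_polyN.
  rewrite (leq_ltn_trans (size_polyC_leq1 _)) ?andbT; last by lia.
  apply: leq_ltn_trans (size_polyD _ _) _; rewrite gtn_max.
  rewrite !(leq_ltn_trans (size_scale_leq _ _)) ?size_polyXn ?size_polyX //; lia.
have Pm : 'X^(q ^ 2) + S \is monic.
  by rewrite monicE lead_coefDl ?lead_coefXn // size_polyXn.
have [|xi hxi xi0] := @root_lift _ _ _ _ _ _ x0 Pm.
  have ra : rho a = 0.
    rewrite /a rmorphM (rho_beta_exp (n := q ^ 2 * gap q)) ?mulr0 //.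
    by rewrite muln_gt0 expn_gt0 (ltnW q1) gap_gt0.
  have rS : map_poly rho S = rho ut *: 'X^q + rho a *: 'X - (rho x1)%:P.
    by rewrite /S rmorphB rmorphD /= !map_polyZ /= map_polyXn map_polyX map_polyC.
  rewrite ra scale0r addr0 in rS.
  have -> : map_poly rho ('X^(q ^ 2) + S) =
      'X^(q ^ 2) + (rho ut *: 'X^q - (rho x1)%:P).
    by rewrite -rS rmorphD /= map_polyXn.
  rewrite /root hornerD hornerXn hornerD hornerZ hornerXn hornerN hornerC; apply/eqP.
  exact: (xi_reduction hb hb' erefl erefl erefl).
have xiE : xi ^+ (q ^ 2) + (ut * xi ^+ q + omega * beta ^+ (q ^ 2 * gap q) * xi - x1) = 0.
  move: hxi; rewrite /root /S !hornerD hornerXn hornerN !hornerZ hornerXn hornerX hornerC.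
  by move/eqP.
have [eta etaE] := trinomial_root (- (beta ^+ (q ^ 2 * gap q) * x1 ^+ q * x1')) (kappa * x1').
have [gam gamE gamK] := lift_gamma hb' (erefl x1) (erefl x1') (erefl ut) xiE etaE.
have [zeta zetaE] := trinomial_root
  (- (beta ^+ (gap q * (q ^ 2 + 1)) * x1 ^+ q * x1')) (- (gam * x1')).
have [t [tX tY]] := lift_point hb hb' (erefl x1) (erefl x1') (erefl ut) xiE xi0 etaE
  gamE gamK zetaE.
exists t, xi, zeta; split=> //.
exact: (rho_zeta hb hb' (erefl x1) (erefl x1') etaE gamE zetaE).
Qed.
End PointLifting.

(** * The unit ball of the residue norm modulo beta *)

Section IntegralFunctions.
Variables (R : realType) (C : fieldType) (v : valuation R C).
Variable X : presentation v.
Implicit Types f g h : pts X -> C.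
Local Notation unit_ball := (residue_ge (X := X) 0).
Local Notation cst a := ((fun=> a) : pts X -> C).

Lemma unit_ballM f g : unit_ball f -> unit_ball g -> unit_ball (f * g).
Proof. by move=> hf hg; have := residue_geM hf hg; rewrite addr0. Qed.
Lemma unit_ballX f n : unit_ball f -> unit_ball (f ^+ n).
Proof. by move=> hf; have := residue_ge_exp n hf; rewrite mul0rn. Qed.
Lemma unit_ball_cst a : (0 <= v a)%E -> unit_ball (cst a).
Proof. exact: residue_ge_cst. Qed.
Lemma unit_ball1 : unit_ball 1.
Proof. by apply: unit_ball_cst; rewrite val1. Qed.
Lemma unit_ballN f : unit_ball f -> unit_ball (- f).
Proof. by move=> h; rewrite -sub0r; apply: residue_geB => //; exact: residue_ge0. Qed.

Lemma unit_ball_scaled_gen i (s : C) : v s = (rad i)%:E ->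
  unit_ball (fun t => @gen _ _ _ X i t / s).
Proof.
move=> hs; have -> : (fun t => @gen _ _ _ X i t / s) = cst s^-1 * @gen _ _ _ X i.
  by apply/funext => t; rewrite mulrC.
rewrite -(addNr (rad i)); apply: residue_geZ (residue_ge_gen i).
by rewrite (valV hs).
Qed.

Variables (b : C) (r : R).
Hypotheses (vb : v b = r%:E) (r_gt0 : 0 < r).

Lemma beta_integral : (0 <= v b)%E. Proof. by rewrite vb lee_fin ltW. Qed.
Lemma unit_ball_betaX n : unit_ball (cst (b ^+ n)).
Proof. by apply: unit_ball_cst; rewrite (val_exp _ vb) lee_fin mulrn_wge0 // ltW. Qed.

Definition cong f g := exists2 h, unit_ball h & f = g + cst b * h.

Lemma cong_refl f : cong f f.
Proof. by exists 0; [exact: residue_ge0 | rewrite mulr0 addr0]. Qed.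
Lemma cong_sym f g : cong f g -> cong g f.
Proof. by move=> [h hh ->]; exists (- h); [exact: unit_ballN | ring]. Qed.
Lemma cong_trans g f h : cong f g -> cong g h -> cong f h.
Proof.
by move=> [s hs ->] [t ht ->]; exists (t + s); [exact: residue_geD | ring].
Qed.
Lemma congD f g f' g' : cong f g -> cong f' g' -> cong (f + f') (g + g').
Proof.
by move=> [s hs ->] [t ht ->]; exists (s + t); [exact: residue_geD | ring].
Qed.
Lemma congN f g : cong f g -> cong (- f) (- g).
Proof. by move=> [s hs ->]; exists (- s); [exact: unit_ballN | ring]. Qed.
Lemma congB f g f' g' : cong f g -> cong f' g' -> cong (f - f') (g - g').
Proof. by move=> h h'; apply: congD => //; exact: congN. Qed.
Lemma congM f g f' g' : unit_ball g -> unit_ball f' ->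
  cong f g -> cong f' g' -> cong (f * f') (g * g').
Proof.
move=> hg hf' [s hs ->] [t ht e]; exists (s * f' + g * t).
  by apply: residue_geD; exact: unit_ballM.
by rewrite mulrDl {1}e; ring.
Qed.
Lemma congX f g n : unit_ball f -> unit_ball g -> cong f g -> cong (f ^+ n) (g ^+ n).
Proof.
move=> hf hg h; elim: n => [|n IH]; first by rewrite !expr0; exact: cong_refl.
by rewrite !exprS; apply: congM => //; exact: unit_ballX.
Qed.
Lemma congMl h f g : unit_ball h -> cong f g -> cong (h * f) (h * g).
Proof. by move=> hh [s hs ->]; exists (h * s); [exact: unit_ballM | ring]. Qed.

Lemma unit_ball_cong f g : unit_ball g -> cong f g -> unit_ball f.
Proof.
move=> hg [h hh ->]; apply: residue_geD => //; apply: unit_ballM => //.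
exact: unit_ball_cst beta_integral.
Qed.

Lemma cong_small n h : (0 < n)%N -> unit_ball h -> cong (cst (b ^+ n) * h) 0.
Proof.
case: n => // n _ hh; exists (cst (b ^+ n) * h); first by apply: unit_ballM => //; exact: unit_ball_betaX.
by rewrite add0r mulrA; congr (_ * _); apply/funext => t; rewrite exprS.
Qed.

(** f' = f' (g g') = (f' f) g' = g' modulo beta. *)
Lemma cong_inv f f' g g' : unit_ball f' -> unit_ball g' -> cong f g ->
  f * f' = 1 -> cong (g * g') 1 -> cong f' g'.
Proof.
move=> hf' hg' fg e1 e2.
apply: (@cong_trans (f' * (g * g'))); last first.
  have {2}-> : g' = f' * (f * g') by rewrite mulrA (mulrC f') e1 mul1r.
  apply: congMl => //; apply: cong_sym.
  have [s hs ->] := fg; exists (s * g'); first exact: unit_ballM.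
  by ring.
by rewrite -{1}(mulr1 f'); apply: congMl => //; exact: cong_sym.
Qed.

End IntegralFunctions.

(** * The coordinates of the affinoid modulo beta *)

Section AffinoidCoordinates.
Variables (R : realType) (C : fieldType) (v : valuation R C).
Variables (p q : nat) (pi pi2 b omega : C).
Hypotheses (charC : p \in [pchar C]) (pq : p.-nat q) (q1 : (1 < q)%N).
Local Notation rb := (rad_beta R q).
Hypotheses (vb : v b = rb%:E) (v_omega : (0 <= v omega)%E).
Hypotheses (piE : pi = omega * b ^+ expo_pi q) (pi2E : pi2 = b ^+ (q ^ 3 + q ^ 2)).
Local Notation X := (Y31e1 v q pi pi2).
Local Notation T := (pts X).
Local Notation unit_ball := (residue_ge (X := X) 0).
Local Notation cst a := ((fun=> a) : T -> C).

(** u, X1, X2, Y1, Y2 are the coordinates 0, ..., 4. *)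
Definition expo (k : 'I_5) : nat :=
  nth 0%N [:: expo_u q; q ^ 4; q ^ 2; q ^ 2; 1]%N k.

Let rb_gt0 := rad_beta_gt0 R q1.

Lemma b_exp_neq0 n : b ^+ n != 0.
Proof. by rewrite expf_neq0 // (val_neq0 vb). Qed.

Lemma v_b_expo k : v (b ^+ expo k) = (Y_rad R q k)%:E.
Proof.
rewrite (val_exp _ vb); congr (_%:E).
case: k => [[|[|[|[|[|//]]]]] hk]; rewrite /Y_rad /expo /=.
- exact: rad_beta_u.
- exact: rad_beta_X1.
- exact: rad_beta_X2.
- exact: rad_beta_X2.
- exact: rad_beta_Y2.
Qed.

Definition scoord k (t : T) : C := Y_coord k t / b ^+ expo k.
Definition iscoord k (t : T) : C := (scoord k t)^-1.

Lemma unit_ball_scoord k : unit_ball (scoord k).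
Proof. exact: (unit_ball_scaled_gen (X := X) (i := (k, false)) (v_b_expo k)). Qed.

Lemma unit_ball_iscoord k : unit_ball (iscoord k).
Proof.
have := unit_ball_scaled_gen (X := X) (i := (k, true)) (valV (v_b_expo k)).
rewrite /= /Y_gen /=; congr (residue_ge _ _); apply/funext => t.
by rewrite /iscoord /scoord invf_div invrK mulrC.
Qed.

Lemma scoordE k t : Y_coord k t = b ^+ expo k * scoord k t.
Proof. by rewrite mulrC divfK ?b_exp_neq0. Qed.

Lemma scoord_neq0 k t : scoord k t != 0.
Proof. by rewrite mulf_neq0 ?invr_eq0 ?b_exp_neq0 // (val_neq0 (Y_coordP k t)). Qed.

Lemma scoordK k : scoord k * iscoord k = 1.
Proof. by apply/funext => t; apply: divff; exact: scoord_neq0. Qed.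

Definition fu := scoord (@Ordinal 5 0 isT).
Definition fx1 := scoord (@Ordinal 5 1 isT).
Definition fx := scoord (@Ordinal 5 2 isT).
Definition fy1 := scoord (@Ordinal 5 3 isT).
Definition fy := scoord (@Ordinal 5 4 isT).
Definition fui := iscoord (@Ordinal 5 0 isT).
Definition fx1i := iscoord (@Ordinal 5 1 isT).
Definition fxi := iscoord (@Ordinal 5 2 isT).
Definition fy1i := iscoord (@Ordinal 5 3 isT).
Definition fyi := iscoord (@Ordinal 5 4 isT).

Lemma pt_uE t : pt_u (Y_pt t) = b ^+ expo_u q * fu t.
Proof. exact: (scoordE (@Ordinal 5 0 isT)). Qed.
Lemma pt_X1E t : pt_X1 (Y_pt t) = b ^+ (q ^ 4) * fx1 t.
Proof. exact: (scoordE (@Ordinal 5 1 isT)). Qed.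
Lemma pt_X2E t : pt_X2 (Y_pt t) = b ^+ (q ^ 2) * fx t.
Proof. exact: (scoordE (@Ordinal 5 2 isT)). Qed.
Lemma pt_Y1E t : pt_Y1 (Y_pt t) = b ^+ (q ^ 2) * fy1 t.
Proof. exact: (scoordE (@Ordinal 5 3 isT)). Qed.
Lemma pt_Y2E t : pt_Y2 (Y_pt t) = b * fy t.
Proof. exact: (scoordE (@Ordinal 5 4 isT)). Qed.

Lemma fctDE (f g : T -> C) t : (f + g) t = f t + g t. Proof. by []. Qed.
Lemma fctME (f g : T -> C) t : (f * g) t = f t * g t. Proof. by []. Qed.
Lemma fctNE (f : T -> C) t : (- f) t = - f t. Proof. by []. Qed.
Lemma fct1E t : (1 : T -> C) t = 1. Proof. by []. Qed.

Definition fct_pointE := (fct_exprE, fctDE, fctME, fctNE, fct1E).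

Lemma pi_u_b z t : pi_u q pi (b ^+ expo_u q * z) (b * t) = b ^+ (q ^ 2) *
  (t ^+ (q ^ 2) + b ^+ (q * gap q) * (z * t ^+ q)
   + b ^+ (gap q * (q ^ 2 + q + 1)) * (omega * t)).
Proof. by rewrite piE pi_u_scale1. Qed.
Lemma pi_u_b2 z t :
  pi_u q pi (b ^+ expo_u q * z) (b ^+ (q ^ 2) * t) = b ^+ (q ^ 4) *
  (t ^+ (q ^ 2) + z * t ^+ q + b ^+ (q ^ 2 * gap q) * (omega * t)).
Proof. by rewrite piE pi_u_scale2. Qed.

(** The equations of the affinoid in rescaled coordinates: every term that does not
    survive in the reduction carries a positive power of beta. *)
Lemma eq_x1 : fx1 = fx ^+ (q ^ 2) + fu * fx ^+ q
  + cst (b ^+ (q ^ 2 * gap q)) * (cst omega * fx).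
Proof.
apply/funext => t; have := erefl (pt_X1 (Y_pt t)).
rewrite {2}/pt_X1 pt_uE pt_X2E pt_X1E pi_u_b2.
by move=> /(mulfI (b_exp_neq0 _)); rewrite !fct_pointE.
Qed.

Lemma eq_y1 : fy1 = fy ^+ (q ^ 2) + cst (b ^+ (q * gap q)) * (fu * fy ^+ q)
  + cst (b ^+ (gap q * (q ^ 2 + q + 1))) * (cst omega * fy).
Proof.
apply/funext => t; have := erefl (pt_Y1 (Y_pt t)).
rewrite {2}/pt_Y1 pt_uE pt_Y2E pt_Y1E pi_u_b.
by move=> /(mulfI (b_exp_neq0 _)); rewrite !fct_pointE.
Qed.

Lemma eq_u : fy1 ^+ (q ^ 2) + fu * fy1 ^+ q
  + cst (b ^+ (q ^ 2 * gap q)) * (cst omega * fy1) = 0.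
Proof.
apply/funext => t; have := pt_Y2_torsion (Y_pt t).
rewrite /pi2_u -[pi_u _ _ _ (pt_Y2 _)]/(pt_Y1 _) pt_uE pt_Y1E pi_u_b2.
move=> e; apply: (mulfI (b_exp_neq0 (q ^ 4))); rewrite mulr0.
by rewrite -[RHS]e !fct_pointE.
Qed.

Lemma eq_mu : - (fx ^+ q * fy1) + fx * fy1 ^+ q
  + cst (b ^+ (q * gap q)) * (fx1 * fy ^+ q)
  + cst (b ^+ (gap q * (q ^ 2 + q + 1))) * (- (fx1 ^+ q * fy)) = 1.
Proof.
apply/funext => t; have := pt_mu2 (Y_pt t).
rewrite /mu2 -[pi_u _ _ _ (pt_Y2 _)]/(pt_Y1 _) -[pi_u _ _ _ (pt_X2 _)]/(pt_X1 _).
rewrite pt_X1E pt_X2E pt_Y1E pt_Y2E => e0; have {e0} := etrans e0 pi2E.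
rewrite !fct_pointE; move: (fx1 t) (fx t) (fy1 t) (fy t) => x1 x y1 y.
rewrite !exprMn -!exprM.
have g := gapE q1.
have e1 : b ^+ (q ^ 4 + q) - b ^+ (q ^ 3 + q ^ 2 + q * gap q) = 0.
  by apply: expr_sub0; nia.
have e2 : b ^+ (q ^ 4 * q + 1) - b ^+ (q ^ 3 + q ^ 2 + gap q * (q ^ 2 + q + 1)) = 0.
  by apply: expr_sub0; nia.
have e3 : (q ^ 2 * q = q ^ 3)%N by nia.
rewrite e3 => e; have B0 := b_exp_neq0 (q ^ 3 + q ^ 2).
apply: (mulfI B0); rewrite mulr1 -{2}e; apply: subr0_eq; move: e1 e2; clear.
rewrite !exprD expr1.
move: b (b ^+ (q ^ 4)) (b ^+ q) (b ^+ (q ^ 4 * q)) (b ^+ (q ^ 3)) (b ^+ (q ^ 2))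
  (b ^+ (q * gap q)) (b ^+ (gap q * (q ^ 2 + q + 1))) => B B4 B1 B5 B3 B2 Bg Bh.
move: (x1 ^+ q) (x ^+ q) (y1 ^+ q) (y ^+ q) => x1q xq y1q yq e1 e2.
rewrite [LHS](_ : _ = - (x1 * yq) * (B4 * B1 - B3 * B2 * Bg)
  + x1q * y * (B5 * B - B3 * B2 * Bh)).
  by rewrite e1 e2 !mulr0 addr0.
by ring.
Qed.


Local Notation cong f g := (cong (X := X) b f g).
Let r0 := rb_gt0.

Lemma unit_ball_omega : unit_ball (cst omega). Proof. exact: unit_ball_cst. Qed.
Lemma unit_ball_fx : unit_ball fx. Proof. exact: unit_ball_scoord. Qed.
Lemma unit_ball_fy : unit_ball fy. Proof. exact: unit_ball_scoord. Qed.
Lemma unit_ball_fu : unit_ball fu. Proof. exact: unit_ball_scoord. Qed.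
Lemma unit_ball_fx1 : unit_ball fx1. Proof. exact: unit_ball_scoord. Qed.
Lemma unit_ball_fy1 : unit_ball fy1. Proof. exact: unit_ball_scoord. Qed.
Lemma unit_ball_fxi : unit_ball fxi. Proof. exact: unit_ball_iscoord. Qed.
Lemma unit_ball_fyi : unit_ball fyi. Proof. exact: unit_ball_iscoord. Qed.
Lemma unit_ball_fui : unit_ball fui. Proof. exact: unit_ball_iscoord. Qed.
Lemma unit_ball_fx1i : unit_ball fx1i. Proof. exact: unit_ball_iscoord. Qed.
Lemma unit_ball_fy1i : unit_ball fy1i. Proof. exact: unit_ball_iscoord. Qed.
Hint Resolve unit_ball_omega unit_ball_fx unit_ball_fy unit_ball_fu unit_ball_fx1 unit_ball_fy1
  unit_ball_fxi unit_ball_fyi unit_ball_fui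
  unit_ball_fx1i unit_ball_fy1i : core.
Local Ltac in_unit_ball := repeat first [solve [auto 1]
  | apply: unit_ballM | apply: unit_ballX | apply: unit_ballN
  | apply: residue_geB | apply: residue_geD | apply: unit_ball1].
Local Ltac gap_pos := have := gap_gt0 q1; move: (gap q) => d d0; nia.

Lemma cong_add_small n f h : (0 < n)%N -> unit_ball h -> cong (f + cst (b ^+ n) * h) f.
Proof.
move=> n0 hh; have := congD (cong_refl b f) (cong_small vb r0 n0 hh).
by rewrite addr0.
Qed.

Lemma cong_fy1 : cong fy1 (fy ^+ (q ^ 2)).
Proof.
rewrite {1}eq_y1; apply: cong_trans (cong_add_small _ _ _) _; [gap_pos|in_unit_ball|].
by apply: cong_add_small; [gap_pos|in_unit_ball].
Qed.

(** The equation mu2 = pi2, with y1 = y^(q^2), reduces to that of the curve. *)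
Lemma cong_curve : cong (- (fx ^+ q * fy ^+ (q ^ 2)) + fx * fy ^+ (q ^ 3)) 1.
Proof.
have e3 : fy ^+ (q ^ 3) = (fy ^+ (q ^ 2)) ^+ q by rewrite -exprM -expnSr.
apply: (@cong_trans _ _ _ _ _ (- (fx ^+ q * fy1) + fx * fy1 ^+ q)).
  apply: cong_sym; apply: congD; [apply: congN|]; apply: congMl; try in_unit_ball.
    exact: cong_fy1.
  by rewrite e3; apply: congX; [in_unit_ball|in_unit_ball|exact: cong_fy1].
apply: cong_sym; rewrite -[X in cong X _]eq_mu.
apply: cong_trans (cong_add_small _ _ _) _; [gap_pos|in_unit_ball|].
by apply: cong_add_small; [gap_pos|in_unit_ball].
Qed.

Lemma cong_inverse_y : cong (fy * (fx * fy ^+ (q ^ 3).-1 - fx ^+ q * fy ^+ (q ^ 2).-1)) 1.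
Proof.
rewrite [X in cong X _](_ : _ = - (fx ^+ q * fy ^+ (q ^ 2)) + fx * fy ^+ (q ^ 3)).
  exact: cong_curve.
have h n : fy ^+ (q ^ n) = fy * fy ^+ (q ^ n).-1.
  by rewrite -exprS prednK // expn_gt0 ltnW.
by rewrite (h 2) (h 3); ring.
Qed.

Lemma cong_fyi : cong fyi (fx * fy ^+ (q ^ 3).-1 - fx ^+ q * fy ^+ (q ^ 2).-1).
Proof.
apply: (cong_inv (f := fy) (g := fy) unit_ball_fyi) (cong_refl _ _) _ cong_inverse_y.
  by in_unit_ball.
exact: scoordK.
Qed.

Lemma cong_fxi : cong fxi (fy ^+ (q ^ 3) - fx ^+ q.-1 * fy ^+ (q ^ 2)).
Proof.
apply: (cong_inv (f := fx) (g := fx) unit_ball_fxi) (cong_refl _ _) _ _.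
- by in_unit_ball.
- exact: scoordK.
rewrite [X in cong X _](_ : _ = - (fx ^+ q * fy ^+ (q ^ 2)) + fx * fy ^+ (q ^ 3)).
  exact: cong_curve.
have -> : fx ^+ q = fx * fx ^+ q.-1 by rewrite -exprS prednK // ltnW.
by ring.
Qed.

Lemma cong_fy1i : cong fy1i (fyi ^+ (q ^ 2)).
Proof.
apply: (cong_inv (f := fy1) (g := fy ^+ (q ^ 2)) unit_ball_fy1i) cong_fy1 _ _.
- by in_unit_ball.
- exact: scoordK.
by rewrite -exprMn scoordK expr1n; exact: cong_refl.
Qed.

Lemma y_cancel n : fy ^+ n * fyi ^+ n = 1.
Proof. by rewrite -exprMn scoordK expr1n. Qed.

(** Solve [pi]_u(Y1) = 0 for u. *)
Lemma cong_fu : cong fu (- (fy ^+ (q ^ 4) * fyi ^+ (q ^ 3))).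
Proof.
have e : fy1 ^+ q * fy1i ^+ q = 1 by rewrite -exprMn scoordK expr1n.
have -> : fu = - (fy1 ^+ (q ^ 2) * fy1i ^+ q) +
    cst (b ^+ (q ^ 2 * gap q)) * (- (cst omega * fy1 * fy1i ^+ q)).
  apply: subr0_eq; rewrite [LHS](_ : _ = (fy1 ^+ (q ^ 2) + fu * fy1 ^+ q
    + cst (b ^+ (q ^ 2 * gap q)) * (cst omega * fy1)) * fy1i ^+ q
    - fu * (fy1 ^+ q * fy1i ^+ q - 1)); last by ring.
  by rewrite eq_u e subrr mulr0 mul0r subr0.
apply: cong_trans (cong_add_small _ _ _) _; [gap_pos|in_unit_ball|].
apply: congN; apply: congM; try in_unit_ball.
  rewrite (_ : q ^ 4 = q ^ 2 * q ^ 2)%N; last by rewrite -expnD.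
  by rewrite exprM; apply: congX; [in_unit_ball|in_unit_ball|exact: cong_fy1].
rewrite (_ : q ^ 3 = q ^ 2 * q)%N; last by rewrite -expnSr.
by rewrite exprM; apply: congX; [in_unit_ball|in_unit_ball|exact: cong_fy1i].
Qed.

Lemma cong_fui : cong fui (- (fyi ^+ (q ^ 4) * fy ^+ (q ^ 3))).
Proof.
apply: (cong_inv (f := fu) unit_ball_fui) cong_fu _ _.
- by in_unit_ball.
- exact: scoordK.
rewrite mulrNN mulrACA y_cancel [fyi ^+ _ * _]mulrC y_cancel mulr1.
exact: cong_refl.
Qed.

Lemma cong_fx1 : cong fx1 (fx ^+ (q ^ 2) + fu * fx ^+ q).
Proof. by rewrite eq_x1; apply: cong_add_small; [gap_pos|in_unit_ball]. Qed.

Lemma cong_curve_frob :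
  cong (- (fx ^+ (q ^ 2) * fy ^+ (q ^ 3)) + fx ^+ q * fy ^+ (q ^ 4)) 1.
Proof.
have hA : unit_ball (- (fx ^+ q * fy ^+ (q ^ 2)) + fx * fy ^+ (q ^ 3)) by in_unit_ball.
have := congX q hA (@unit_ball1 _ _ _ X) cong_curve; rewrite expr1n.
congr (cong _ _); apply/funext => t.
rewrite !fct_pointE (frobD charC pq) (frobN charC pq).
by rewrite !exprMn -!exprM mulnn -!expnSr.
Qed.

(** By the q-th power of the equation of the curve, x^(q^2) + u x^q is the inverse of
    - y^(q^3). *)
Lemma cong_fx1i : cong fx1i (- fy ^+ (q ^ 3)).
Proof.
apply: (cong_inv (f := fx1) unit_ball_fx1i) cong_fx1 _ _.
- by in_unit_ball.
- exact: scoordK.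
apply: cong_trans cong_curve_frob; rewrite mulrN mulrDl opprD.
apply: congD; first exact: cong_refl.
rewrite -mulrN mulrAC.
apply: (@cong_trans _ _ _ _ _
  (- (fy ^+ (q ^ 4) * fyi ^+ (q ^ 3)) * (- fy ^+ (q ^ 3)) * fx ^+ q)).
  apply: congM; [in_unit_ball|in_unit_ball| |exact: cong_refl].
  by apply: congM; [in_unit_ball|in_unit_ball|exact: cong_fu|exact: cong_refl].
rewrite mulrNN -(mulrA (fy ^+ _)) [fyi ^+ _ * _]mulrC y_cancel mulr1 mulrC.
exact: cong_refl.
Qed.


Local Notation W := (vring v).

Lemma fx_vint t : fx t \in vint v. Proof. exact: residue_ge_val unit_ball_fx. Qed.
Lemma fy_vint t : fy t \in vint v. Proof. exact: residue_ge_val unit_ball_fy. Qed.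
Definition xr t : W := VRing (fx_vint t).
Definition yr t : W := VRing (fy_vint t).

Definition ev (G : {poly {poly W}}) : T -> C :=
  fun t => vring_val (ev2 (xr t) (yr t) G).

Lemma evD G H : ev (G + H) = ev G + ev H.
Proof. by apply/funext => t; rewrite /ev ev2D vring_valD. Qed.
Lemma evB G H : ev (G - H) = ev G - ev H.
Proof. by apply/funext => t; rewrite /ev ev2B vring_valB. Qed.
Lemma evM G H : ev (G * H) = ev G * ev H.
Proof. by apply/funext => t; rewrite /ev ev2M vring_valM. Qed.
Lemma evC a : ev a%:P%:P = cst (vring_val a).
Proof. by apply/funext => t; rewrite /ev ev2C. Qed.
Lemma evX : ev 'X%:P = fx. Proof. by apply/funext => t; rewrite /ev ev2X. Qed.
Lemma evY : ev 'X = fy. Proof. by apply/funext => t; rewrite /ev ev2Y. Qed.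
Lemma ev1 : ev 1 = 1. Proof. exact: evC 1. Qed.
Lemma evXn G n : ev (G ^+ n) = ev G ^+ n.
Proof. by elim: n => [|n IH]; rewrite ?expr0 ?ev1 // !exprS evM IH. Qed.
Lemma evN G : ev (- G) = - ev G.
Proof. by apply/funext => t; rewrite /ev -sub0r ev2B vring_valB (ev2C _ _ 0) sub0r. Qed.

Lemma unit_ball_ev G : unit_ball (ev G).
Proof.
elim/poly2_ind: G => [a|||G H|G H].
- by rewrite evC; apply: unit_ball_cst; exact: (vringP a).
- by rewrite evX.
- by rewrite evY.
- by rewrite evD; exact: residue_geD.
- by rewrite evM; exact: unit_ballM.
Qed.

Lemma ev_curve : cong (ev (curve_poly W q)) 0.
Proof.
rewrite /curve_poly evB ev1 evD evN !evM !evXn evX evY.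
have := congB cong_curve (cong_refl b (1 : T -> C)).
by rewrite subrr.
Qed.

(** The functions that are polynomials in x and y modulo beta. They form a ring, and
    contain the generators by the preceding congruences. *)
Definition poly_rep f := exists G, cong f (ev G).

Lemma poly_rep_cong f g : cong f g -> poly_rep g -> poly_rep f.
Proof. by move=> h [G hG]; exists G; exact: cong_trans hG. Qed.
Lemma poly_rep_cst a : (0 <= v a)%E -> poly_rep (cst a).
Proof.
move=> ha; have ha' : a \in vint v by [].
by exists (VRing ha')%:P%:P; rewrite evC; exact: cong_refl.
Qed.
Lemma poly_rep1 : poly_rep 1. Proof. by exists 1; rewrite ev1; exact: cong_refl. Qed.
Lemma poly_repD f g : poly_rep f -> poly_rep g -> poly_rep (f + g).
Proof. by move=> [G hG] [H hH]; exists (G + H); rewrite evD; exact: congD. Qed.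
Lemma poly_repN f : poly_rep f -> poly_rep (- f).
Proof. by move=> [G hG]; exists (- G); rewrite evN; exact: congN. Qed.
Lemma poly_repM f g : poly_rep f -> poly_rep g -> poly_rep (f * g).
Proof.
move=> [G hG] [H hH]; exists (G * H); rewrite evM; apply: congM => //.
  exact: unit_ball_ev.
exact: (unit_ball_cong vb r0 (unit_ball_ev H) hH).
Qed.
Lemma poly_repX f n : poly_rep f -> poly_rep (f ^+ n).
Proof.
move=> h; elim: n => [|n IH]; first by rewrite expr0; exact: poly_rep1.
by rewrite exprS; exact: poly_repM.
Qed.
Lemma poly_rep_fx : poly_rep fx. Proof. by exists 'X%:P; rewrite evX; exact: cong_refl. Qed.
Lemma poly_rep_fy : poly_rep fy. Proof. by exists 'X; rewrite evY; exact: cong_refl. Qed.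

Local Ltac in_poly_rep := repeat first [exact: poly_rep_fx | exact: poly_rep_fy | assumption
  | apply: poly_repN | apply: poly_repX | apply: poly_repM | apply: poly_repD].

Lemma poly_rep_scoord k : poly_rep (scoord k) /\ poly_rep (iscoord k).
Proof.
have ryi : poly_rep fyi by apply: poly_rep_cong cong_fyi _; in_poly_rep.
have ru : poly_rep fu by apply: poly_rep_cong cong_fu _; in_poly_rep.
case: k => [[|[|[|[|[|//]]]]] hk]; rewrite (bool_irrelevance hk isT).
- by split=> //; apply: (poly_rep_cong (f := fui)) cong_fui _; in_poly_rep.
- split; first by apply: (poly_rep_cong (f := fx1)) cong_fx1 _; in_poly_rep.
  by apply: (poly_rep_cong (f := fx1i)) cong_fx1i _; in_poly_rep.
- by split; [exact: poly_rep_fx|apply: (poly_rep_cong (f := fxi)) cong_fxi _; in_poly_rep].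
- split; first by apply: (poly_rep_cong (f := fy1)) cong_fy1 _; in_poly_rep.
  by apply: (poly_rep_cong (f := fy1i)) cong_fy1i _; in_poly_rep.
by split; [exact: poly_rep_fy|exact: ryi].
Qed.

Definition tau (i : idx X) : C :=
  if i.2 then (b ^+ expo i.1)^-1 else b ^+ expo i.1.

Lemma v_tau i : v (tau i) = (rad i)%:E.
Proof.
case: i => k [] /=; rewrite /tau /= /Y_genrad /=; last exact: v_b_expo.
by rewrite (valV (v_b_expo k)).
Qed.

Lemma poly_rep_gen i : poly_rep (fun t => @gen _ _ _ X i t / tau i).
Proof.
case: i => k []; have [h1 h2] := poly_rep_scoord k; rewrite /tau /=; last exact: h1.
rewrite (_ : (fun t => _) = iscoord k) //; apply/funext => t.
by rewrite /Y_gen /= /iscoord /scoord invf_div invrK mulrC.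
Qed.

Lemma v_tau_monom (n : {ffun idx X -> nat}) :
  v (\prod_i tau i ^+ n i) = (weight n)%:E.
Proof.
rewrite /weight; elim/big_rec2: _ => [|i s r' _ IH]; first exact: val1.
by rewrite valM IH (val_exp _ (v_tau i)).
Qed.

Lemma poly_rep_prod (I : Type) (s : seq I) (F : I -> T -> C) :
  (forall i, poly_rep (F i)) -> poly_rep (fun t => \prod_(i <- s) F i t).
Proof.
move=> h; elim: s => [|i s IH].
  rewrite (_ : (fun t => _) = 1); first exact: poly_rep1.
  by apply/funext => t; rewrite big_nil.
rewrite (_ : (fun t => _) = F i * (fun t => \prod_(i <- s) F i t)).
  exact: poly_repM.
by apply/funext => t; rewrite big_cons.
Qed.

Lemma poly_rep_sum (I : Type) (s : seq I) (F : I -> T -> C) :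
  (forall i, poly_rep (F i)) -> poly_rep (fun t => \sum_(i <- s) F i t).
Proof.
move=> h; elim: s => [|i s IH].
  exists 0; rewrite (_ : (fun t => _) = ev 0); first exact: cong_refl.
  by apply/funext => t; rewrite big_nil /ev (ev2C _ _ 0).
rewrite (_ : (fun t => _) = F i * 1 + (fun t => \sum_(i <- s) F i t)).
  by rewrite mulr1; exact: poly_repD.
by apply/funext => t; rewrite big_cons mulr1.
Qed.

(** Cut the series off; each remaining term is an integral constant times a product
    of rescaled generators. *)
Lemma unit_ball_rep f : unit_ball f -> poly_rep f.
Proof.
move=> hf; have [c [N [gc hr]]] := residue_ge_truncate rb hf.
apply: (@poly_rep_cong _ (psum c N)).
  exists (cst b^-1 * (f - psum c N)).
    by rewrite -(addNr rb); apply: residue_geZ hr; rewrite (valV vb).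
  apply/funext => t; rewrite !fct_pointE /= mulrA divff ?mul1r; last exact: (val_neq0 vb).
  by rewrite addrC subrK.
apply: poly_rep_sum => n.
rewrite (_ : (fun t => _) = cst (c n * \prod_i tau i ^+ n i) *
   (fun t => \prod_i (@gen _ _ _ X i t / tau i) ^+ n i)).
  apply: poly_repM; last first.
    apply: poly_rep_prod => i; have := poly_repX (n i) (poly_rep_gen i).
    by congr (poly_rep _); apply/funext => t; rewrite fct_pointE.
  by apply: poly_rep_cst; rewrite valM v_tau_monom; exact: gc.
apply/funext => t; rewrite fct_pointE /= -mulrA -big_split /=; congr (_ * _).
apply: eq_bigr => i _; rewrite -exprMn mulrC divfK //.
exact: val_neq0 (v_tau i).
Qed.


(** * Residue norm and values *)

Local Notation k := (residue_field v).
Local Notation red := (map_poly2 (residue v)).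
(* k is algebraically closed *)
Hypothesis ksplit : forall P : {poly k}, P \is monic ->
  exists rs : seq k, P = \prod_(r <- rs) ('X - r%:P).
Hypothesis charR : p \in [pchar k].
Hypothesis points_lift : forall x0 y0 : k, ev2 x0 y0 (curve_poly k q) = 0 ->
  exists t : T, residue v (xr t) = x0 /\ residue v (yr t) = y0.

Lemma residue_ev t G : residue v (ev2 (xr t) (yr t) G) = 0 <-> (0 < v (ev G t))%E.
Proof. by split=> [/eqP|h]; [|apply/eqP]; rewrite residue_eq0. Qed.

(** The points of the affinoid reduce onto all points of the curve, so the
    Nullstellensatz applies. *)
Lemma small_values_red G : (forall t, (0 < v (ev G t))%E) ->
  exists H, red G = H * curve_poly k q.
Proof.
move=> h; apply: (curve_nullstellensatz q1 (frob_natr0 charR pq q1) ksplit).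
move=> x0 y0 /points_lift[t [<- <-]]; rewrite -ev2_map.
exact/residue_ev.
Qed.

Lemma small_values_wpoly (S : {poly {poly W}}) : (size S <= q)%N ->
  (forall t, (0 < v (ev (wsubst q S) t))%E) -> red S = 0.
Proof.
move=> sS h; apply: (wpoly_vanish q1 (frob_natr0 charR pq q1) ksplit).
  exact: leq_trans (size_poly _ _) sS.
move=> x0 y0 /points_lift[t [<- <-]]; rewrite ev2_map_wsubst.
exact/residue_ev.
Qed.

Lemma ev_scale a G : ev (a%:P%:P * G) = cst (vring_val a) * ev G.
Proof. by rewrite evM evC. Qed.

Lemma cst_small (a : C) : (rb%:E <= v a)%E -> exists2 a' : C, (0 <= v a')%E & a = b * a'.
Proof.
move=> ha; exists (b^-1 * a); last by rewrite mulrA divff ?mul1r // (val_neq0 vb).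
have := val_leM (a := - rb) (x := b^-1) _ ha; rewrite addNr; apply.
by rewrite (valV vb).
Qed.

(** Modulo beta and up to a power of the unit y, f is given by a normal form S. Were
    the content a of S larger than beta, S / a would have small values and a nonzero
    reduction. The gain of a full factor beta does not depend on f; this uniformity
    makes the descent that follows terminate. *)
Lemma small_values_cong f : unit_ball f -> (forall t, (rb%:E <= v (f t))%E) -> cong f 0.
Proof.
move=> hf fs; have [G hG] := unit_ball_rep hf.
have [N [S [H [e sS]]]] := curve_normal_form q1 G.
have eN : cong (fy ^+ N * f) (ev (wsubst q S)).
  apply: (@cong_trans _ _ _ _ _ (fy ^+ N * ev G)).
    by apply: congMl hG; in_unit_ball.
  rewrite -evY -evXn -evM e evD evM.
  have := congD (cong_refl b (ev (wsubst q S))) (congMl (unit_ball_ev H) ev_curve).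
  by rewrite mulr0 addr0.
suff hS : cong (ev (wsubst q S)) 0.
  have -> : f = fyi ^+ N * (fy ^+ N * f) by rewrite mulrA (mulrC (fyi ^+ N)) y_cancel mul1r.
  rewrite -(mulr0 (fyi ^+ N)); apply: congMl; first by in_unit_ball.
  exact: cong_trans eN hS.
have [S0|S0] := eqVneq S 0.
  rewrite S0 -[0]/(0%:P) wsubstC rmorph0.
  have -> : ev 0 = 0 by rewrite -[0 in LHS]/(0%:P%:P) evC; apply/funext => t; exact: vring_val0.
  exact: cong_refl.
have [a [S1 [a0 eS rS1]]] := poly_content S0.
have eS' : ev (wsubst q S) = cst (vring_val a) * ev (wsubst q S1).
  by rewrite eS wsubstM wsubstC map_polyC /= ev_scale.
have sS1 : (size S1 <= q)%N.
  apply: leq_trans sS; rewrite leqNgt; apply/negP => lt.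
  have h0 : a%:P * lead_coef S1 = 0.
    by rewrite lead_coefE -coefCM -eS nth_default //; case: (size S1) lt.
  have S10 : S1 = 0.
    apply/eqP; rewrite -lead_coef_eq0; apply/eqP/polyP => i; rewrite coef0.
    apply: vring_val_inj; apply: (mulfI a0).
    by rewrite -vring_valM -coefCM h0 coef0 vring_val0 mulr0.
  by move: rS1; rewrite S10 rmorph0 eqxx.
have va : (rb%:E <= v (vring_val a))%E.
  rewrite leNgt; apply/negP => lt; move/eqP: rS1; apply.
  apply: small_values_wpoly => // t.
  have ht : (rb%:E <= v (ev (wsubst q S) t))%E.
    have [g hg eg] := eN.
    have -> : ev (wsubst q S) t = fy t ^+ N * f t - b * g t.
      have := congr1 (fun F : T -> C => F t) eg.
      by rewrite !fct_pointE => ->; rewrite addrK.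
    apply: val_leB.
      rewrite -[rb]add0r; apply: val_leM (fs t).
      by rewrite -fct_exprE; apply: residue_ge_val; in_unit_ball.
    rewrite -[rb]addr0; apply: val_leM; first by rewrite vb.
    exact: residue_ge_val.
  rewrite eS' fct_pointE /= valM in ht; rewrite ltNge; apply/negP => le0.
  have := lt_le_trans lt ht; apply/negP; rewrite -leNgt.
  by rewrite -[leRHS]adde0 leeD2l.
have [a' ha' ea] := cst_small va.
exists (cst a' * ev (wsubst q S1)); first by apply: unit_ballM; [exact: unit_ball_cst|exact: unit_ball_ev].
by rewrite add0r eS' ea; apply/funext => t; rewrite !fct_pointE /= mulrA.
Qed.

Lemma unit_ball_of_bounded m f : residue_ge (- (rb *+ m)) f ->
  (forall t, (0 <= v (f t))%E) -> unit_ball f.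
Proof.
elim: m f => [|m IH] f hf fi; first by rewrite mulr0n oppr0 in hf.
apply: IH => //.
have vbm : v (b ^+ m.+1) = (rb *+ m.+1)%:E by rewrite (val_exp _ vb).
have hg : unit_ball (cst (b ^+ m.+1) * f).
  by rewrite -(subrr (rb *+ m.+1)); apply: residue_geZ hf; rewrite vbm.
have [|h hh eh] := small_values_cong hg.
  move=> t; rewrite fct_pointE /= -[rb]addr0; apply: val_leM (fi t).
  by rewrite vbm lee_fin mulrS lerDl mulrn_wge0 // ltW.
have -> : f = cst (b ^+ m)^-1 * h.
  apply/funext => t; have := congr1 (fun F : T -> C => F t) eh.
  rewrite !fct_pointE /= add0r exprS -mulrA => /(mulfI (val_neq0 vb)) <-.
  by rewrite mulrA mulVf ?mul1r // b_exp_neq0.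
rewrite -[- _]addr0; apply: residue_geZ hh.
by rewrite (valV (val_exp m vb)).
Qed.

(** Integral values imply residue norm at most 1: multiply f by a power of beta to
    bring it into the unit ball, then divide by beta as often. *)
Lemma unit_ball_integral f : analytic f -> (forall t, (0 <= v (f t))%E) -> unit_ball f.
Proof.
move=> /analytic_residue[M hM] fi.
have [m hm] : exists m : nat, `|M| / rb < m%:R.
  by exists (Num.bound (`|M| / rb)); apply: archi_boundP; rewrite divr_ge0 // ltW.
apply: (@unit_ball_of_bounded m) fi; apply: residue_geW hM.
move: hm; rewrite ltr_pdivrMr // mulr_natl => hm.
by rewrite lerNl; apply: le_trans (ltW hm); rewrite -normrN ler_norm.
Qed.


(** * The reduction *)

Local Notation curve := (curve_ring k q).
Local Notation toCurve := (quot_by_pi (curve_eq k q)).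

Lemma unit_ball_pb (f : pb_ring X) : unit_ball (pb_fun f).
Proof.
have /asboolP hf := pb_funP f; apply: unit_ball_integral; first by case: hf.
by move=> t; exact: power_bounded_val.
Qed.

Lemma cong_top_nilpotent f g : cong f g -> top_nilpotent (f - g).
Proof.
move=> [h hh ->]; rewrite addrC addKr; apply: (residue_ge_top_nilpotent r0).
by rewrite -[rb]addr0; apply: residue_geZ hh; rewrite vb.
Qed.

Lemma toCurve_eq0 G : toCurve G = 0 <-> exists H, G = H * curve_poly k q.
Proof. exact: quot_by_eq0. Qed.

Lemma ev_pb_subproof G : ev G \in pbounded (X := X).
Proof. by apply/asboolP/residue_ge_power_bounded; exact: unit_ball_ev. Qed.
Definition ev_pb G : pb_ring X := PbRing (ev_pb_subproof G).

(** The graph of the isomorphism: f and c are represented by the same polynomial over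
    the valuation ring. It is a function because a polynomial with small values
    reduces to 0, and injective because a polynomial that reduces to 0 is
    topologically nilpotent. *)
Definition reduces_to (f : pb_ring X) (c : curve) : Prop :=
  exists2 G, c = toCurve (red G) & top_nilpotent (pb_fun f - ev G).

Lemma reduces_to_total f : exists c, reduces_to f c.
Proof.
have [G hG] := unit_ball_rep (unit_ball_pb f); exists (toCurve (red G)), G => //.
exact: cong_top_nilpotent.
Qed.

Lemma reduces_to_fun f f' c c' : reduces_to f c -> reduces_to f' c' ->
  top_nilpotent (pb_fun f - pb_fun f') -> c = c'.
Proof.
move=> [G -> hG] [G' -> hG'] hf; apply/eqP; rewrite -subr_eq0 -!rmorphB.
apply/eqP/toCurve_eq0/small_values_red => t.
apply: top_nilpotent_val; rewrite evB.
have -> : ev G - ev G' = (pb_fun f - pb_fun f') - (pb_fun f - ev G)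
   + (pb_fun f' - ev G') by ring.
rewrite -[X in _ + X]opprK; apply: top_nilpotentB; first exact: top_nilpotentB.
rewrite -sub0r; apply: top_nilpotentB => //.
apply: (residue_ge_top_nilpotent r0); exact: residue_ge0.
Qed.

(** G differs from a multiple of the equation, which is small on the affinoid, by a
    polynomial with small coefficients. *)
Lemma top_nilpotent_ev G : toCurve (red G) = 0 -> top_nilpotent (ev G).
Proof.
move=> /toCurve_eq0[H0 e].
have [H hH] := map_poly2_lift H0 (fun c => ex_intro _ (repr c) (residueK c)).
pose D := G - H * curve_poly W q.
have rD : red D = 0 by rewrite rmorphB (rmorphM red) map_poly2_curve hH e subrr.
have -> : ev G = ev D - (0 - ev H * ev (curve_poly W q)).
  by rewrite /D evB evM; ring.
apply: top_nilpotentB; last first.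
  apply: cong_top_nilpotent; apply: cong_sym; rewrite -(mulr0 (ev H)).
  by apply: congMl; [exact: unit_ball_ev|exact: ev_curve].
have [D0|D0] := eqVneq D 0.
  apply: (residue_ge_top_nilpotent r0).
  rewrite D0; have -> : ev 0 = 0.
    by rewrite -[0 in LHS]/(0%:P%:P) evC; apply/funext => t; exact: vring_val0.
  exact: residue_ge0.
have [a [D1 [a0 eD rD1]]] := poly_content D0.
have ra : residue v a = 0 by apply: map_poly2_content rD1; rewrite -eD.
have [r hr] := val_fin v a0.
have r_gt0 : 0 < r.
  by move/eqP: ra; rewrite residue_eq0 unfold_in hr lte_fin.
apply: (residue_ge_top_nilpotent r_gt0); rewrite eD ev_scale -[r]addr0.
by apply: residue_geZ; [rewrite hr|exact: unit_ball_ev].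
Qed.

Lemma reduces_to0 f : reduces_to f 0 -> top_nilpotent (pb_fun f).
Proof.
move=> [G e hG]; rewrite -[pb_fun f](subrK (ev G)) -[X in _ + X]opprK.
apply: top_nilpotentB => //; rewrite -sub0r; apply: top_nilpotentB.
  by apply: (residue_ge_top_nilpotent r0); exact: residue_ge0.
exact: top_nilpotent_ev.
Qed.

Lemma reduces_toB f g c d : reduces_to f c -> reduces_to g d ->
  reduces_to (f - g) (c - d).
Proof.
move=> [G -> hG] [H -> hH]; exists (G - H); first by rewrite !rmorphB.
rewrite evB pb_funB.
rewrite [X in top_nilpotent X](_ : _ = (pb_fun f - ev G) - (pb_fun g - ev H)).
  exact: top_nilpotentB.
by ring.
Qed.

Lemma reduces_toM f g c d : reduces_to f c -> reduces_to g d ->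
  reduces_to (f * g) (c * d).
Proof.
move=> [G -> hG] [H -> hH]; exists (G * H); first by rewrite !rmorphM.
rewrite evM pb_funM.
rewrite [X in top_nilpotent X](_ : _ = pb_fun f * (pb_fun g - ev H)
   - (0 - ev H * (pb_fun f - ev G))); last by ring.
have z : top_nilpotent (0 : pts X -> C).
  by apply: (residue_ge_top_nilpotent r0); exact: residue_ge0.
apply: top_nilpotentB; last apply: top_nilpotentB => //.
  by apply: top_nilpotentM => //; apply/asboolP; exact: (pb_funP f).
by apply: top_nilpotentM => //; apply: residue_ge_power_bounded; exact: unit_ball_ev.
Qed.

Lemma top_nilpotent0 : top_nilpotent (0 : pts X -> C).
Proof. by apply: (residue_ge_top_nilpotent r0); exact: residue_ge0. Qed.

Lemma reduces_to_ev G : reduces_to (ev_pb G) (toCurve (red G)).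
Proof. by exists G; rewrite //= subrr; exact: top_nilpotent0. Qed.

Lemma reduces_to_cst a : reduces_to (pb_cst X a) (curve_scalar q (residue v a)).
Proof.
exists a%:P%:P; first by rewrite map_poly2C.
by rewrite evC /= subrr; exact: top_nilpotent0.
Qed.

Definition phi_pb (f : pb_ring X) : curve := projT1 (cid (reduces_to_total f)).

Lemma phi_pbP f : reduces_to f (phi_pb f).
Proof. exact: projT2 (cid (reduces_to_total f)). Qed.

Lemma phi_pb_eq f c : reduces_to f c -> phi_pb f = c.
Proof.
move=> h; apply: reduces_to_fun (phi_pbP f) h _.
by rewrite subrr; exact: top_nilpotent0.
Qed.

Local Notation RX := (reduction X).

Definition phi (x : RX) : curve := phi_pb (repr x).

Lemma phi_reduce f : phi (reduce X f) = phi_pb f.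
Proof.
apply: reduces_to_fun (phi_pbP _) (phi_pbP _) _.
exact/reduce_eq/reduceK.
Qed.

Lemma phi_zmod : zmod_morphism phi.
Proof.
move=> x y; rewrite -(reduceK x) -(reduceK y) -rmorphB !phi_reduce.
by apply: phi_pb_eq; apply: reduces_toB; exact: phi_pbP.
Qed.

Lemma phi_monoid : monoid_morphism phi.
Proof.
split; last first.
  move=> x y; rewrite -(reduceK x) -(reduceK y) -rmorphM !phi_reduce.
  by apply: phi_pb_eq; apply: reduces_toM; exact: phi_pbP.
rewrite -(rmorph1 (reduce X)) phi_reduce; apply: phi_pb_eq.
exists 1; first by rewrite !rmorph1.
by rewrite ev1 pb_fun1 subrr; exact: top_nilpotent0.
Qed.

HB.instance Definition _ := GRing.isZmodMorphism.Build RX curve phi phi_zmod.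
HB.instance Definition _ := GRing.isMonoidMorphism.Build RX curve phi phi_monoid.

Lemma phi_inj : injective phi.
Proof.
move=> x y /eqP; rewrite -subr_eq0 -rmorphB => /eqP e; apply/eqP; rewrite -subr_eq0.
apply/eqP; rewrite -(reduceK (x - y)) -(rmorph0 (reduce X)).
apply/reduce_eq; rewrite (_ : pb_fun 0 = 0) // subr0; apply: reduces_to0.
by rewrite -e; exact: phi_pbP.
Qed.

Lemma phi_surj c : exists x, phi x = c.
Proof.
have [G hG] := map_poly2_lift (repr c) (fun c => ex_intro _ (repr c) (residueK c)).
exists (reduce X (ev_pb G)); rewrite phi_reduce; apply: phi_pb_eq.
have -> : c = toCurve (red G) by rewrite hG; apply/esym/quot_byK.
exact: reduces_to_ev.
Qed.

Lemma reduction_iso : exists phi : {rmorphism RX -> curve}, bijective phi /\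
  forall a : W, phi (reduce X (pb_cst X a)) = curve_scalar q (residue v a).
Proof.
exists phi; split.
  have /choice[psi psiK] := phi_surj; exists psi => // x.
  by apply: phi_inj; exact: psiK.
by move=> a; rewrite [LHS]phi_reduce; apply: phi_pb_eq; exact: reduces_to_cst.
Qed.

End AffinoidCoordinates.

(** * From the local field to the scaling constants *)

Lemma local_field_card (R : realType) p q (F : fieldType) (vF : valuation R F) pi :
  local_field p q vF pi -> p.-nat q /\ (1 < q)%N.
Proof.
move=> [charF _ _ _ [e [e' eK e'K]]].
have pq : p.-nat q by exact: (fin_field_card e'K eK (residue_field_pchar vF charF)).
split=> //; have := oner_neq0 (residue_field vF).
rewrite -(inj_eq (can_inj e'K)); case: (e' 1) (e' 0) => a ha [c hc].
by rewrite -(inj_eq val_inj) /=; lia.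
Qed.

Theorem lemma4p4 (R : realType) (p q : nat)
  (F : fieldType) (vF : valuation R F) (pi : F)
  (hF : local_field p q vF pi)
  (Fbar : closedFieldType) (C : fieldType) (v : valuation R C)
  (i : {rmorphism F -> Fbar}) (j : {rmorphism Fbar -> C})
  (hC : completed_closure vF v i j)
  (pi2 : C) (hpi2 : LT_generator q (j (i pi)) pi2) :
  exists phi : {rmorphism reduction (Y31e1 v q (j (i pi)) pi2) ->
                          curve_ring (residue_field v) q},
    bijective phi /\
    forall a : vring v,
      phi (reduce _ (pb_cst _ a)) = curve_scalar q (residue v a).
Proof.
have [pq q1] := local_field_card hF; have charF := local_char hF.
have charK : p \in [pchar Fbar] by rewrite (fmorph_pchar i).
have charC : p \in [pchar C] by rewrite (fmorph_pchar j).
have dense := closure_dense hC.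
have vpi : pullback v j (i pi) = 1%:E.
  by rewrite /= (closure_val hC) (local_uniformizer hF).
have [p2 Ep2 gen] := LT_generator_descent q1 hpi2.
have [beta [omega [kappa scal]]] := scaling_exists charK pq q1 vpi gen.
subst pi2; pose b := j (vring_val beta).
have vb : v b = (rad_beta R q)%:E by exact: (scal_val scal).
have v_omega : (0 <= v (j (vring_val omega)))%E by exact: (vringP omega).
have piE : j (i pi) = j (vring_val omega) * b ^+ expo_pi q.
  by rewrite {1}(scal_pi scal) rmorphM rmorphXn.
have pi2E : j p2 = b ^+ (q ^ 3 + q ^ 2).
  by rewrite -(scal_beta scal) rmorphXn.
apply: (reduction_iso (q1 := q1) (vb := vb) charC pq v_omega piE pi2E
  (residue_split dense) (residue_field_pchar v charC)).
move=> x0 y0; rewrite ev2_curve => /eqP; rewrite subr_eq0 => /eqP on_curve.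
have [t [xi [zeta [tX tY <- <-]]]] :=
  curve_point_lift dense charK pq q1 gen scal on_curve.
have b0 n : b ^+ n != 0 by rewrite expf_neq0 // (val_neq0 vb).
exists t; split; rewrite /=; congr (residue v _); apply: vring_val_inj => /=.
  apply: (mulfI (b0 (q ^ 2)%N)); rewrite -(pt_X2E vb) tX.
  by rewrite rmorphM rmorphXn.
apply: (mulfI (val_neq0 vb)); rewrite -(pt_Y2E vb) tY.
by rewrite rmorphM.
Qed.
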